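(* Let $G$ be a computable subgroup of $S_\infty$. If there is an infinite $G$-orbit, then $R^{ce}_G$ is $\Sigma^0_3$-universal, i.e., every $\Sigma^0_3$ equivalence relation on $\omega$ is computably reducible to $R^{ce}_G$.
   Context: $(W_e)_{e\in\omega}$ is a standard uniform enumeration of the c.e.\ subsets of $\omega$. A computable subgroup of $S_\infty$ is a computable group acting computably by permutations on $\omega$; a $G$-orbit is a set $\{\gamma(x):\gamma\in G\}$ for some $x\in\omega$. $i\,R^{ce}_G\,j\iff(\exists\gamma\in G)(W_i=\{\gamma(x):x\in W_j\})$. $E$ is computably reducible to $F$ if there is a computable $f$ with $x\,E\,y\iff f(x)\,F\,f(y)$. *)

(* Defs.v *)
From Stdlib Require Import Arith Lia List RelationClasses.
From Stdlib Require Cantor.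

(** Stdlib's Cantor bijection [nat * nat <-> nat]. *)
Notation "⟨ a , b ⟩" := (Cantor.to_nat (a, b)) (at level 0, format "⟨ a ,  b ⟩").
Definition pi1 (n : nat) : nat := fst (Cantor.of_nat n).
Definition pi2 (n : nat) : nat := snd (Cantor.of_nat n).

(** Programs for the unary partial recursive functions; functions of several
    arguments are handled through the pairing above.  The identity is
    [CPair CFst CSnd], since the pairing is onto. *)
Inductive code : Type :=
| CZero | CSucc | CFst | CSnd
| CPair (c d : code)
| CComp (c d : code)
| CPrec (c d : code)
| CMu (c : code).

(** [eval c n r]: program [c] halts on input [n] with output [r].
    [CPrec c d] computes h with h⟨a,0⟩ = c(a), h⟨a,k+1⟩ = d⟨a,⟨k,h⟨a,k⟩⟩⟩;
    [CMu c] computes the least r with c⟨n,r⟩ = 0, all c⟨n,m⟩ with m < r being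
    required to converge. *)
Fixpoint eval (c : code) (n r : nat) {struct c} : Prop :=
  match c with
  | CZero => r = 0
  | CSucc => r = S n
  | CFst => r = pi1 n
  | CSnd => r = pi2 n
  | CPair c d => exists a b, eval c n a /\ eval d n b /\ r = ⟨a, b⟩
  | CComp c d => exists m, eval d n m /\ eval c m r
  | CPrec c d =>
      nat_rect (fun _ => nat -> Prop)
        (eval c (pi1 n))
        (fun k H r' => exists m, H m /\ eval d ⟨pi1 n, ⟨k, m⟩⟩ r')
        (pi2 n) r
  | CMu c =>
      eval c ⟨n, r⟩ 0 /\ forall m, m < r -> exists k, eval c ⟨n, m⟩ (S k)
  end.

Lemma eval_functional (c : code) : forall n r r',
  eval c n r -> eval c n r' -> r = r'.
Proof.
  induction c as [| | | |c IHc d IHd|c IHc d IHd|c IHc d IHd|c IHc];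
    intros n r r' H H'; cbn [eval] in H, H'; try congruence.
  - destruct H as (a & b & Ha & Hb & ->), H' as (a' & b' & Ha' & Hb' & ->).
    now rewrite (IHc _ _ _ Ha Ha'), (IHd _ _ _ Hb Hb').
  - destruct H as (m & Hm & Hr), H' as (m' & Hm' & Hr').
    rewrite (IHd _ _ _ Hm Hm') in Hr. eauto.
  - revert r r' H H'. induction (pi2 n) as [|k IHk]; cbn; intros r r' H H'.
    + eauto.
    + destruct H as (m & Hm & Hr), H' as (m' & Hm' & Hr').
      rewrite (IHk _ _ Hm Hm') in Hr. eauto.
  - destruct H as [H0 Hlt], H' as [H0' Hlt'].
    destruct (Nat.lt_trichotomy r r') as [L|[L|L]]; [|exact L|].
    + destruct (Hlt' _ L) as [k Hk]. now specialize (IHc _ _ _ H0 Hk).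
    + destruct (Hlt _ L) as [k Hk]. now specialize (IHc _ _ _ H0' Hk).
Qed.

Fixpoint code_index (c : code) : nat :=
  match c with
  | CZero => 0
  | CSucc => 1
  | CFst => 2
  | CSnd => 3
  | CPair c d => 4 + 4 * ⟨code_index c, code_index d⟩
  | CComp c d => 5 + 4 * ⟨code_index c, code_index d⟩
  | CPrec c d => 6 + 4 * ⟨code_index c, code_index d⟩
  | CMu c => 7 + 4 * code_index c
  end.

Lemma pair_inj (a b a' b' : nat) : ⟨a, b⟩ = ⟨a', b'⟩ -> a = a' /\ b = b'.
Proof.
  intros H. apply (f_equal Cantor.of_nat) in H.
  rewrite !Cantor.cancel_of_to in H. now inversion H.
Qed.

Lemma code_index_inj (c : code) : forall d, code_index c = code_index d -> c = d.
Proof.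
  induction c as [| | | |c1 IH1 c2 IH2|c1 IH1 c2 IH2|c1 IH1 c2 IH2|c IH];
    intros [| | | |d1 d2|d1 d2|d1 d2|d]; cbn [code_index]; intros H;
    try reflexivity; try (exfalso; lia);
    try (destruct (pair_inj (code_index c1) (code_index c2)
                            (code_index d1) (code_index d2)) as [E1 E2];
         [lia|]; now rewrite (IH1 _ E1), (IH2 _ E2)).
  rewrite (IH d); [reflexivity|lia].
Qed.

Lemma code_index_surj (e : nat) : exists c, code_index c = e.
Proof.
  induction e as [e IH] using lt_wf_ind.
  destruct (le_lt_dec 4 e) as [H4|H4].
  2:{ destruct e as [|[|[|[|e]]]]; [exists CZero|exists CSucc|exists CFst|exists CSnd|lia];
      reflexivity. }
  pose proof (Nat.div_mod_eq (e - 4) 4) as D.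
  pose proof (Nat.mod_upper_bound (e - 4) 4 ltac:(lia)) as B.
  remember ((e - 4) / 4) as q. remember ((e - 4) mod 4) as s.
  destruct (Nat.eq_dec s 3) as [->|H3].
  { destruct (IH q ltac:(lia)) as [c Hc]. exists (CMu c). cbn [code_index]. lia. }
  pose proof (Cantor.cancel_to_of q) as Q.
  destruct (Cantor.of_nat q) as [a b].
  pose proof (Cantor.to_nat_non_decreasing a b) as L.
  destruct (IH a ltac:(lia)) as [c Hc]. destruct (IH b ltac:(lia)) as [d Hd].
  subst a b.
  destruct s as [|[|[|s]]]; [exists (CPair c d)|exists (CComp c d)|exists (CPrec c d)|lia];
    cbn [code_index]; lia.
Qed.

(** W_e is the domain of the e-th partial recursive function; [code_index] is a
    bijection, so exactly one [c] is selected. *)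
Definition W (e x : nat) : Prop :=
  exists c, code_index c = e /\ exists r, eval c x r.

Definition computable (f : nat -> nat) : Prop :=
  exists c, forall n, eval c n (f n).

Definition computable2 (f : nat -> nat -> nat) : Prop :=
  computable (fun p => f (pi1 p) (pi2 p)).

Definition computable_set (A : nat -> Prop) : Prop :=
  exists chi : nat -> bool,
    computable (fun n => Nat.b2n (chi n)) /\ forall n, A n <-> chi n = true.

Definition sigma03 (E : nat -> nat -> Prop) : Prop :=
  exists P : nat -> Prop, computable_set P /\
    forall x y, E x y <->
      exists a, forall b, exists c, P ⟨x, ⟨y, ⟨a, ⟨b, c⟩⟩⟩⟩.

Definition computably_reducible (E F : nat -> nat -> Prop) : Prop :=
  exists f, computable f /\ forall x y, E x y <-> F (f x) (f y).

Definition sigma03_universal (F : nat -> nat -> Prop) : Prop :=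
  forall E : nat -> nat -> Prop,
    Equivalence E -> sigma03 E -> computably_reducible E F.

(** A computable group acting computably on ω.  Its elements form a computable
    set [gdom] of natural numbers; the values of the operations outside [gdom]
    are irrelevant.  Each element acts by a permutation, by the group axioms. *)
Record computable_perm_group : Type := {
  gdom : nat -> Prop;
  gone : nat;
  gmul : nat -> nat -> nat;
  ginv : nat -> nat;
  gact : nat -> nat -> nat;
  gdom_computable : computable_set gdom;
  gmul_computable : computable2 gmul;
  ginv_computable : computable ginv;
  gact_computable : computable2 gact;
  gone_dom : gdom gone;
  gmul_dom : forall g h, gdom g -> gdom h -> gdom (gmul g h);
  ginv_dom : forall g, gdom g -> gdom (ginv g);
  gmul_assoc : forall g h k, gdom g -> gdom h -> gdom k ->
    gmul g (gmul h k) = gmul (gmul g h) k;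
  gmul_one_l : forall g, gdom g -> gmul gone g = g;
  gmul_one_r : forall g, gdom g -> gmul g gone = g;
  gmul_inv_l : forall g, gdom g -> gmul (ginv g) g = gone;
  gmul_inv_r : forall g, gdom g -> gmul g (ginv g) = gone;
  gact_one : forall x, gact gone x = x;
  gact_mul : forall g h x, gdom g -> gdom h ->
    gact (gmul g h) x = gact g (gact h x)
}.

Definition orbit (G : computable_perm_group) (x y : nat) : Prop :=
  exists g, gdom G g /\ y = gact G g x.

Definition infinite (A : nat -> Prop) : Prop :=
  ~ exists l : list nat, forall y, A y -> In y l.

Definition R_ce (G : computable_perm_group) (i j : nat) : Prop :=
  exists g, gdom G g /\
    forall y, W i y <-> exists x, W j x /\ y = gact G g x.

(* Main.v *)
From Stdlib Require Import Arith Lia List Bool RelationClasses.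
From Stdlib Require Import Classical ConstructiveEpsilon.
Require Import Defs.
Import ListNotations.

(** The danger to a node is an older join. A join made after the node's own stage can be chosen to
    carry old elements away from everything marked, but a join fixed earlier cannot be chosen again:
    exercised between two visits to the node, it could carry a forbidden number into a set. The tree
    is shaped to exclude this. A child standing for a silent guess is indexed by the number of
    firings so far, so it is never resumed once the guess fires. It follows that an older node
    revisited while the node in question still has visits to come is one of its ancestors, and that
    its joins already belong to the node's own conjecture.

    Each node consults its guess at its own visit number, not at the stage, so a node visited
    infinitely often sees every event. One stage belongs to each node reached; the joins fixed there
    are inherited by all descendants and enforced again at each visit through them. *)

(** Write a Σ⁰₃ equivalence relation [E] as "some guess about (x, y) recurs", where
    a guess is an effective event that may occur infinitely often.  An infinite
    injury construction enumerates sets A_x inside the infinite orbit.  A node of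
    its tree holds a conjecture about which of the first guesses recur, the
    induced equivalence relation on indices, and for every x a group element
    h_x; at each visit to the node, A_x is made to agree with h_x h_y⁻¹ A_y for all
    x and y which the node considers equivalent.  When a new guess joins two classes,
    their h's are adjusted by a group element moving everything seen so far off
    itself, which exists by P. M. Neumann's separation lemma; so the join
    respects all earlier commitments.  A node may therefore put a fresh element z into
    A_x, keep g⁻¹z out of A_y for inequivalent x and y, and never be
    injured on the true path. *)

Lemma pi1_pair a b : pi1 ⟨a, b⟩ = a.
Proof. unfold pi1. now rewrite Cantor.cancel_of_to. Qed.

Lemma pi2_pair a b : pi2 ⟨a, b⟩ = b.
Proof. unfold pi2. now rewrite Cantor.cancel_of_to. Qed.

Lemma pair_pi n : ⟨pi1 n, pi2 n⟩ = n.
Proof.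
  unfold pi1, pi2. rewrite <- surjective_pairing. apply Cantor.cancel_to_of.
Qed.

Lemma pair_ge a b : a <= ⟨a, b⟩ /\ b <= ⟨a, b⟩.
Proof. pose proof (Cantor.to_nat_non_decreasing a b). lia. Qed.

#[local] Opaque Cantor.to_nat Cantor.of_nat pi1 pi2.

(** * Effective functions between encodable types *)

(* Encodings are bijective, so a program that is correct on codes is total;
   this is what makes primitive recursion on codes of lists legitimate. *)
Class encodable (A : Type) := {
  enc : A -> nat;
  enc_inj : forall a b, enc a = enc b -> a = b;
  enc_surj : forall n, exists a, enc a = n
}.

#[export] Instance encodable_nat : encodable nat.
Proof. refine {| enc n := n |}; eauto. Defined.

#[export] Instance encodable_prod A B `{encodable A} `{encodable B} :
  encodable (A * B).
Proof.
  refine {| enc p := ⟨enc (fst p), enc (snd p)⟩ |}.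
  - intros [a b] [a' b'] E. destruct (pair_inj _ _ _ _ E) as [Ea Eb]. cbn in Ea, Eb.
    now rewrite (enc_inj _ _ Ea), (enc_inj _ _ Eb).
  - intros n. destruct (enc_surj (A := A) (pi1 n)) as [a Ha], (enc_surj (A := B) (pi2 n)) as [b Hb].
    exists (a, b). cbn. now rewrite Ha, Hb, pair_pi.
Defined.

Fixpoint enc_list {A} `{encodable A} (l : list A) : nat :=
  match l with
  | [] => 0
  | a :: l' => S ⟨enc a, enc_list l'⟩
  end.

#[export] Instance encodable_list A `{encodable A} : encodable (list A).
Proof.
  refine {| enc := enc_list |}.
  - induction a as [|a l IH]; intros [|b l'] E; try discriminate E; [reflexivity|].
    injection E as E. destruct (pair_inj _ _ _ _ E) as [E1 E2].
    now rewrite (enc_inj _ _ E1), (IH _ E2).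
  - induction n as [n IH] using lt_wf_ind. destruct n as [|n].
    { now exists []. }
    destruct (enc_surj (A := A) (pi1 n)) as [a Ha].
    destruct (IH (pi2 n)) as [l Hl].
    { pose proof (pair_ge (pi1 n) (pi2 n)) as L. rewrite pair_pi in L. lia. }
    exists (a :: l). cbn. now rewrite Ha, Hl, pair_pi.
Defined.

Definition effective {A B} `{encodable A} `{encodable B} (f : A -> B) : Prop :=
  exists c, forall a, eval c (enc a) (enc (f a)).

Definition effective_pred {A} `{encodable A} (p : A -> bool) : Prop :=
  effective (fun a => Nat.b2n (p a)).

Definition effective2 {A B C} `{encodable A} `{encodable B} `{encodable C}
  (f : A -> B -> C) : Prop :=
  effective (fun p => f (fst p) (snd p)).

Definition effective3 {A B C D} `{encodable A} `{encodable B} `{encodable C}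
  `{encodable D} (f : A -> B -> C -> D) : Prop :=
  effective (fun p => f (fst p) (fst (snd p)) (snd (snd p))).

Definition effective4 {A B C D F} `{encodable A} `{encodable B} `{encodable C}
  `{encodable D} `{encodable F} (f : A -> B -> C -> D -> F) : Prop :=
  effective (fun p => f (fst p) (fst (snd p)) (fst (snd (snd p))) (snd (snd (snd p)))).

Section Closure.

Context {A : Type} `{encodable A}.

Lemma effective_ext {B} `{encodable B} (f g : A -> B) :
  (forall a, f a = g a) -> effective f -> effective g.
Proof. intros E [c Hc]. exists c. intros a. now rewrite <- E. Qed.

Lemma effective_id : effective (fun a : A => a).
Proof.
  exists (CPair CFst CSnd). intros a. cbn.
  exists (pi1 (enc a)), (pi2 (enc a)). now rewrite pair_pi.
Qed.

Lemma effective_comp {B C} `{encodable B} `{encodable C} (f : B -> C) (g : A -> B) :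
  effective f -> effective g -> effective (fun a => f (g a)).
Proof.
  intros [c Hc] [d Hd]. exists (CComp c d). intros a. cbn. eauto.
Qed.

Lemma effective_pair {B C} `{encodable B} `{encodable C} (f : A -> B) (g : A -> C) :
  effective f -> effective g -> effective (fun a => (f a, g a)).
Proof.
  intros [c Hc] [d Hd]. exists (CPair c d). intros a. cbn. eauto.
Qed.

Lemma effective_fst {B C} `{encodable B} `{encodable C} (f : A -> B * C) :
  effective f -> effective (fun a => fst (f a)).
Proof.
  intros [c Hc]. exists (CComp CFst c). intros a. cbn.
  exists (enc (f a)). split; [apply Hc|]. cbn. now rewrite pi1_pair.
Qed.

Lemma effective_snd {B C} `{encodable B} `{encodable C} (f : A -> B * C) :
  effective f -> effective (fun a => snd (f a)).
Proof.
  intros [c Hc]. exists (CComp CSnd c). intros a. cbn.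
  exists (enc (f a)). split; [apply Hc|]. cbn. now rewrite pi2_pair.
Qed.

Lemma effective_S (f : A -> nat) : effective f -> effective (fun a => S (f a)).
Proof.
  intros [c Hc]. exists (CComp CSucc c). intros a. cbn. eauto.
Qed.

Lemma effective_nat (n : nat) : effective (fun _ : A => n).
Proof.
  induction n as [|n IH]; [|now apply effective_S].
  now exists CZero.
Qed.

Lemma effective_const {B} `{encodable B} (b : B) : effective (fun _ : A => b).
Proof. destruct (effective_nat (enc b)) as [c Hc]. now exists c. Qed.

Lemma effective_rect {B} `{encodable B} (m : A -> nat) (f : A -> B)
    (g : A -> nat -> B -> B) :
  effective m -> effective f -> effective3 g ->
  effective (fun a => nat_rect (fun _ => B) (f a) (fun n r => g a n r) (m a)).
Proof.
  intros [cm Hm] [c Hc] [d Hd].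
  exists (CComp (CPrec c d) (CPair (CPair CFst CSnd) cm)). intros a. cbn.
  exists ⟨enc a, m a⟩. split.
  { exists (enc a), (m a). repeat split; [|apply Hm].
    exists (pi1 (enc a)), (pi2 (enc a)). now rewrite pair_pi. }
  rewrite pi1_pair, pi2_pair. induction (m a) as [|n IH]; cbn; [apply Hc|].
  eexists. split; [exact IH|].
  exact (Hd (a, (n, _))).
Qed.

Lemma effective_comp2 {B C D} `{encodable B} `{encodable C} `{encodable D}
    (f : B -> C -> D) (g : A -> B) (h : A -> C) :
  effective2 f -> effective g -> effective h -> effective (fun a => f (g a) (h a)).
Proof.
  intros Hf Hg Hh.
  exact (effective_comp _ _ Hf (effective_pair _ _ Hg Hh)).
Qed.

Lemma effective_comp3 {B C D F} `{encodable B} `{encodable C} `{encodable D}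
    `{encodable F} (f : B -> C -> D -> F) (g : A -> B) (h : A -> C) (i : A -> D) :
  effective3 f -> effective g -> effective h -> effective i ->
  effective (fun a => f (g a) (h a) (i a)).
Proof.
  intros Hf Hg Hh Hi.
  exact (effective_comp _ _ Hf (effective_pair _ _ Hg (effective_pair _ _ Hh Hi))).
Qed.

Lemma effective_comp4 {B C D F K} `{encodable B} `{encodable C} `{encodable D}
    `{encodable F} `{encodable K} (f : B -> C -> D -> F -> K)
    (g : A -> B) (h : A -> C) (i : A -> D) (j : A -> F) :
  effective4 f -> effective g -> effective h -> effective i -> effective j ->
  effective (fun a => f (g a) (h a) (i a) (j a)).
Proof.
  intros Hf Hg Hh Hi Hj.
  exact (effective_comp _ _ Hf (effective_pair _ _ Hg
    (effective_pair _ _ Hh (effective_pair _ _ Hi Hj)))).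
Qed.

End Closure.

Ltac effective_step :=
  lazymatch goal with
  | H : effective ?f |- effective ?f => exact H
  | |- effective2 _ => unfold effective2
  | |- effective3 _ => unfold effective3
  | |- effective4 _ => unfold effective4
  | |- effective_pred _ => unfold effective_pred
  | |- effective (fun x => x) => apply effective_id
  | |- effective (fun x => (_, _)) => apply effective_pair
  | |- effective (fun x => fst _) => apply effective_fst
  | |- effective (fun x => snd _) => apply effective_snd
  | |- effective (fun x => S _) => apply effective_S
  | |- effective fst => apply (effective_fst (fun x => x))
  | |- effective snd => apply (effective_snd (fun x => x))
  | |- effective (fun x => ?c) => apply effective_const
  end.

Section Data.

Context {A B : Type} `{encodable A} `{encodable B}.

Lemma effective_if (p : A -> bool) (f g : A -> B) :
  effective_pred p -> effective f -> effective g ->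
  effective (fun a => if p a then f a else g a).
Proof.
  intros Hp Hf Hg.
  apply (effective_ext
    (fun a => nat_rect (fun _ => B) (g a) (fun _ _ => f a) (Nat.b2n (p a)))).
  { intros a. now destruct (p a). }
  apply effective_rect; [exact Hp|exact Hg|].
  unfold effective3. apply (effective_comp f fst Hf). repeat effective_step.
Qed.

Lemma effective_predecessor (f : A -> nat) :
  effective f -> effective (fun a => Nat.pred (f a)).
Proof.
  intros Hf.
  apply (effective_ext
    (fun a => nat_rect (fun _ => nat) 0 (fun n _ => n) (f a))).
  { intros a. now destruct (f a). }
  apply effective_rect; repeat effective_step.
Qed.

Lemma effective_add (f g : A -> nat) :
  effective f -> effective g -> effective (fun a => f a + g a).
Proof.
  intros Hf Hg.
  apply (effective_ext
    (fun a => nat_rect (fun _ => nat) (g a) (fun _ r => S r) (f a))).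
  { intros a. induction (f a); cbn; congruence. }
  apply effective_rect; repeat effective_step.
Qed.

End Data.

Lemma effective_sub {A} `{encodable A} (f g : A -> nat) :
  effective f -> effective g -> effective (fun a => f a - g a).
Proof.
  intros Hf Hg.
  apply (effective_ext
    (fun a => nat_rect (fun _ => nat) (f a) (fun _ r => Nat.pred r) (g a))).
  { intros a. induction (g a) as [|n IH]; cbn; [lia|]. rewrite IH. lia. }
  apply effective_rect; [assumption..|].
  apply effective_predecessor. repeat effective_step.
Qed.

Section Predicates.

Context {A : Type} `{encodable A}.

Lemma effective_neg (p : A -> bool) :
  effective_pred p -> effective_pred (fun a => negb (p a)).
Proof.
  intros Hp. apply (effective_ext (fun a => if p a then 0 else 1)).
  { intros a. now destruct (p a). }
  apply effective_if; [assumption|apply effective_const..].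
Qed.

Lemma effective_and (p q : A -> bool) :
  effective_pred p -> effective_pred q -> effective_pred (fun a => p a && q a).
Proof.
  intros Hp Hq. apply (effective_ext (fun a => if p a then Nat.b2n (q a) else 0)).
  { intros a. now destruct (p a). }
  apply effective_if; [assumption..|apply effective_const].
Qed.

Lemma effective_eqb (f g : A -> nat) :
  effective f -> effective g -> effective_pred (fun a => f a =? g a).
Proof.
  intros Hf Hg.
  apply (effective_ext (fun a => 1 - ((f a - g a) + (g a - f a)))).
  { intros a. destruct (Nat.eqb_spec (f a) (g a)); cbn [Nat.b2n]; lia. }
  apply effective_sub; [apply effective_const|].
  apply effective_add; now apply effective_sub.
Qed.

Lemma effective_enc {B} `{encodable B} (f : A -> B) :
  effective f -> effective (fun a => enc (f a)).
Proof. intros [c Hc]. now exists c. Qed.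

End Predicates.

(** Recursion on the code of the list, with a step that reads only the predecessor of the code and
    discards the recursive value. [CPrec] still requires all intermediate values to exist, and they
    do because every number codes a pair of a head and a tail. *)
Lemma effective_list_case {A B C} `{encodable A} `{encodable B} `{encodable C}
    (l : A -> list B) (f : A -> C) (g : A -> B -> list B -> C) :
  effective l -> effective f -> effective3 g ->
  effective (fun a => match l a with [] => f a | b :: t => g a b t end).
Proof.
  intros [cl Hl] [cf Hf] [cg Hg].
  exists (CComp (CPrec cf (CComp cg (CPair CFst (CComp CFst CSnd))))
                (CPair (CPair CFst CSnd) cl)).
  intros a. cbn. exists ⟨enc a, enc (l a)⟩. split.
  { exists (enc a), (enc (l a)). repeat split; [|apply Hl].
    exists (pi1 (enc a)), (pi2 (enc a)). now rewrite pair_pi. }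
  rewrite pi1_pair, pi2_pair.
  assert (Hstep : forall k r, exists b t, k = ⟨enc b, enc t⟩ /\
    eval (CComp cg (CPair CFst (CComp CFst CSnd))) ⟨enc a, ⟨k, r⟩⟩ (enc (g a b t))).
  { intros k r. destruct (enc_surj (A := B * list B) k) as [[b t] Ek]. exists b, t.
    split; [now rewrite <- Ek|]. cbn.
    exists ⟨enc a, k⟩. split.
    - exists (enc a), k. rewrite pi1_pair. repeat split.
      exists ⟨k, r⟩. now rewrite pi1_pair, pi2_pair.
    - rewrite <- Ek. exact (Hg (a, (b, t))). }
  cbn [eval] in Hstep.
  assert (Htot : forall n, exists r, nat_rect (fun _ => nat -> Prop)
    (eval cf (enc a))
    (fun k R r' => exists m, R m /\ eval (CComp cg (CPair CFst (CComp CFst CSnd)))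
       ⟨enc a, ⟨k, m⟩⟩ r') n r).
  { induction n as [|n [r IH]]; cbn [nat_rect]; [eauto|].
    destruct (Hstep n r) as (b & t & _ & Hr). eauto. }
  destruct (l a) as [|b t]; cbn [enc encodable_list enc_list nat_rect].
  { apply Hf. }
  destruct (Htot ⟨enc b, enc_list t⟩) as [r Hr].
  exists r. split; [exact Hr|].
  destruct (Hstep ⟨enc b, enc_list t⟩ r) as (b' & t' & E & Hg').
  destruct (pair_inj _ _ _ _ E) as [Eb Et].
  change (enc t = enc t') in Et. apply enc_inj in Eb, Et. subst b' t'. exact Hg'.
Qed.

Lemma effective_cons {A B} `{encodable A} `{encodable B}
    (f : A -> B) (l : A -> list B) :
  effective f -> effective l -> effective (fun a => f a :: l a).
Proof.
  intros [c Hc] [d Hd]. exists (CComp CSucc (CPair c d)). intros a. cbn.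
  exists ⟨enc (f a), enc (l a)⟩. split; [|reflexivity]. eauto.
Qed.

Lemma enc_length {A} `{encodable A} (l : list A) : length l <= enc l.
Proof.
  induction l as [|a l IH]; cbn; [lia|].
  pose proof (pair_ge (enc a) (enc_list l)). cbn in IH. lia.
Qed.

Section Lists.

Context {A B C : Type} `{encodable A} `{encodable B} `{encodable C}.

(** A loop on pairs of remaining list and accumulator. It runs [enc (l a)] times, which is at least
    the length of the list; the surplus rounds idle on the empty list. *)
Lemma effective_fold_left (l : A -> list B) (i : A -> C) (g : A -> C -> B -> C) :
  effective l -> effective i -> effective3 g ->
  effective (fun a => fold_left (fun r b => g a r b) (l a) (i a)).
Proof.
  intros Hl Hi Hg.
  set (step a (q : list B * C) :=
    match fst q with [] => q | b :: t => (t, g a (snd q) b) end).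
  assert (E : forall a n m r, length m <= n ->
    nat_rect (fun _ => (list B * C)%type) (m, r) (fun _ q => step a q) n
    = ([], fold_left (fun r b => g a r b) m r)).
  { intros a n.
    induction n as [|n IH]; intros m r L.
    - destruct m; [reflexivity|cbn in L; lia].
    - assert (Esh : forall q, nat_rect (fun _ => (list B * C)%type) q
        (fun _ q => step a q) (S n) = nat_rect (fun _ => (list B * C)%type) (step a q)
        (fun _ q => step a q) n).
      { intros q. clear. induction n as [|n IH]; cbn in *; congruence. }
      rewrite Esh. destruct m as [|b m]; unfold step at 1; cbn [fst snd].
      + apply IH. cbn. lia.
      + rewrite IH; [reflexivity|]. cbn in L. lia. }
  apply (effective_ext (fun a => snd (nat_rect (fun _ => (list B * C)%type)
    (l a, i a) (fun _ q => step a q) (enc (l a))))).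
  { intros a. rewrite E; [reflexivity|apply enc_length]. }
  apply effective_snd, effective_rect.
  - destruct Hl as [c Hc]. now exists c.
  - now apply effective_pair.
  - unfold effective3, step.
    apply effective_list_case; [repeat effective_step..|].
    unfold effective3. apply effective_pair; [repeat effective_step|].
    apply (effective_comp3 g); repeat effective_step; exact Hg.
Qed.

End Lists.

Lemma effective_rev {A B} `{encodable A} `{encodable B} (l : A -> list B) :
  effective l -> effective (fun a => rev (l a)).
Proof.
  intros Hl.
  apply (effective_ext (fun a => fold_left (fun r b => b :: r) (l a) [])).
  { intros a. rewrite <- (app_nil_r (rev (l a))). generalize (@nil B).
    induction (l a) as [|b t IH]; intros m; cbn; [reflexivity|].
    rewrite IH, <- app_assoc. reflexivity. }
  apply effective_fold_left; [assumption|apply effective_const|].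
  unfold effective3. apply effective_cons; repeat effective_step.
Qed.

Lemma effective_last {A} `{encodable A} (l : A -> list nat) :
  effective l -> effective (fun a => last (l a) 0).
Proof.
  intros Hl.
  apply (effective_ext (fun a => match rev (l a) with [] => 0 | b :: _ => b end)).
  { intros a. rewrite <- (rev_involutive (l a)) at 2.
    destruct (rev (l a)) as [|b t]; [reflexivity|]. cbn. now rewrite last_last. }
  apply (effective_list_case _ _ (fun _ b _ => b));
    [now apply effective_rev|apply effective_const|].
  unfold effective3. repeat effective_step.
Qed.

Lemma effective_removelast {A B} `{encodable A} `{encodable B} (l : A -> list B) :
  effective l -> effective (fun a => removelast (l a)).
Proof.
  intros Hl.
  apply (effective_ext
    (fun a => rev (match rev (l a) with [] => [] | _ :: t => t end))).
  { intros a. rewrite <- (rev_involutive (l a)) at 2.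
    destruct (rev (l a)) as [|b t]; [reflexivity|]. cbn. now rewrite removelast_last. }
  apply effective_rev, (effective_list_case _ _ (fun _ _ t => t));
    [now apply effective_rev|apply effective_const|].
  unfold effective3. repeat effective_step.
Qed.

Lemma effective_fold_right {A B C} `{encodable A} `{encodable B} `{encodable C}
    (l : A -> list B) (i : A -> C) (g : A -> B -> C -> C) :
  effective l -> effective i -> effective3 g ->
  effective (fun a => fold_right (fun b r => g a b r) (i a) (l a)).
Proof.
  intros Hl Hi Hg.
  apply (effective_ext (fun a => fold_left (fun r b => g a b r) (rev (l a)) (i a))).
  { intros a. now rewrite <- fold_left_rev_right, rev_involutive. }
  apply (effective_fold_left _ _ (fun a r b => g a b r));
    [now apply effective_rev|assumption|].
  unfold effective3. apply (effective_comp3 g); repeat effective_step; exact Hg.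
Qed.

Section MoreLists.

Context {A B C : Type} `{encodable A} `{encodable B} `{encodable C}.

Lemma effective_app (l m : A -> list B) :
  effective l -> effective m -> effective (fun a => l a ++ m a).
Proof.
  intros Hl Hm.
  apply (effective_ext (fun a => fold_right (fun b r => b :: r) (m a) (l a))).
  { intros a. induction (l a); cbn; congruence. }
  apply effective_fold_right; [assumption..|].
  unfold effective3. apply effective_cons; repeat effective_step.
Qed.

Lemma effective_map (l : A -> list B) (g : A -> B -> C) :
  effective l -> effective2 g -> effective (fun a => map (fun b => g a b) (l a)).
Proof.
  intros Hl Hg.
  apply (effective_ext (fun a => fold_right (fun b r => g a b :: r) [] (l a))).
  { intros a. induction (l a); cbn; congruence. }
  apply (effective_fold_right _ _ (fun a b r => g a b :: r));
    [assumption|apply effective_const|].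
  unfold effective3. apply effective_cons; [|repeat effective_step].
  apply (effective_comp2 g); repeat effective_step; exact Hg.
Qed.

End MoreLists.

Lemma effective_flat_map {A B C} `{encodable A} `{encodable B} `{encodable C}
    (l : A -> list B) (g : A -> B -> list C) :
  effective l -> effective2 g ->
  effective (fun a => flat_map (fun b => g a b) (l a)).
Proof.
  intros Hl Hg.
  apply (effective_ext (fun a => fold_right (fun b r => g a b ++ r) [] (l a))).
  { intros a. induction (l a); cbn; congruence. }
  apply (effective_fold_right _ _ (fun a b r => g a b ++ r));
    [assumption|apply effective_const|].
  unfold effective3. apply effective_app; [|repeat effective_step].
  apply (effective_comp2 g); repeat effective_step; exact Hg.
Qed.

Lemma effective_seq {A} `{encodable A} (n : A -> nat) :
  effective n -> effective (fun a => seq 0 (n a)).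
Proof.
  intros Hn.
  apply (effective_ext (fun a => nat_rect (fun _ => list nat) []
    (fun i r => r ++ [i]) (n a))).
  { intros a. induction (n a) as [|i IH]; [reflexivity|].
    cbn [nat_rect]. now rewrite IH, seq_S. }
  apply effective_rect; [assumption|apply effective_const|].
  unfold effective3. apply effective_app; [repeat effective_step|].
  apply effective_cons; repeat effective_step.
Qed.

Lemma effective_length {A B} `{encodable A} `{encodable B} (l : A -> list B) :
  effective l -> effective (fun a => length (l a)).
Proof.
  intros Hl.
  apply (effective_ext (fun a => fold_right (fun _ r => S r) 0 (l a))).
  { intros a. induction (l a); cbn; congruence. }
  apply effective_fold_right; [assumption|apply effective_const|].
  unfold effective3. repeat effective_step.
Qed.

Lemma effective_forallb {A B} `{encodable A} `{encodable B}
    (l : A -> list B) (p : A -> B -> bool) :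
  effective l -> effective_pred (fun q => p (fst q) (snd q)) ->
  effective_pred (fun a => forallb (fun b => p a b) (l a)).
Proof.
  intros Hl Hp.
  apply (effective_ext (fun a => fold_right (fun b r => if p a b then r else 0)
    1 (l a))).
  { intros a. induction (l a) as [|b t IH]; cbn; [reflexivity|].
    rewrite IH. now destruct (p a b). }
  apply (effective_fold_right _ _ (fun a b r => if p a b then r else 0));
    [assumption|apply effective_const|].
  unfold effective3. apply effective_if; [|repeat effective_step..].
  apply (effective_comp2 (fun a b => Nat.b2n (p a b)));
    repeat effective_step; exact Hp.
Qed.

Lemma effective_existsb {A B} `{encodable A} `{encodable B}
    (l : A -> list B) (p : A -> B -> bool) :
  effective l -> effective_pred (fun q => p (fst q) (snd q)) ->
  effective_pred (fun a => existsb (fun b => p a b) (l a)).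
Proof.
  intros Hl Hp.
  apply (effective_ext (fun a => Nat.b2n (negb (forallb (fun b => negb (p a b)) (l a))))).
  { intros a. f_equal. induction (l a) as [|b t IH]; cbn; [reflexivity|].
    rewrite <- IH. now destruct (p a b). }
  apply effective_neg, (effective_forallb _ (fun a b => negb (p a b)));
    [assumption|].
  now apply (effective_neg (fun q => p (fst q) (snd q))).
Qed.

(** * Unbounded search and the enumeration of c.e. sets *)

Lemma effective_search {A} `{encodable A} (p : A -> nat -> bool) :
  effective_pred (fun q => p (fst q) (snd q)) ->
  (forall a, exists n, p a n = true) ->
  exists f : A -> nat, effective f /\ forall a, p a (f a) = true.
Proof.
  intros Hp Hex.
  (* The least witness is extracted from mere existence because [p] is decidable; it is exactly the
     value that [CMu] returns. *)
  assert (Hs : forall a, {n | p a n = true /\ forall m, p a m = true -> n <= m}).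
  { intros a. apply epsilon_smallest; [|apply Hex].
    intros n. destruct (p a n); auto. }
  exists (fun a => proj1_sig (Hs a)). split; [|intros a; apply (proj2_sig (Hs a))].
  destruct (effective_neg _ Hp) as [c Hc]. exists (CMu c). intros a.
  destruct (Hs a) as [n [Hn Hmin]]. cbn. split.
  - pose proof (Hc (a, n)) as E. cbn in E. now rewrite Hn in E.
  - intros m L. exists 0. pose proof (Hc (a, m)) as E. cbn in E.
    destruct (p a m) eqn:Em; [|exact E]. specialize (Hmin _ Em). lia.
Qed.

Lemma effective_computable2 (f : nat -> nat -> nat) : computable2 f -> effective2 f.
Proof.
  intros [c Hc]. exists c. intros [a b]. specialize (Hc ⟨a, b⟩).
  now rewrite pi1_pair, pi2_pair in Hc.
Qed.

Lemma effective_pi1 {A} `{encodable A} (f : A -> nat) :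
  effective f -> effective (fun a => pi1 (f a)).
Proof. intros [c Hc]. exists (CComp CFst c). intros a. cbn. eauto. Qed.

Lemma effective_pi2 {A} `{encodable A} (f : A -> nat) :
  effective f -> effective (fun a => pi2 (f a)).
Proof. intros [c Hc]. exists (CComp CSnd c). intros a. cbn. eauto. Qed.

Lemma effective_to_nat {A} `{encodable A} (f g : A -> nat) :
  effective f -> effective g -> effective (fun a => ⟨f a, g a⟩).
Proof. intros Hf Hg. exact (effective_pair _ _ Hf Hg). Qed.

Ltac effectivity_step :=
  lazymatch goal with
  | H : effective ?g |- effective ?g => exact H
  | H : effective ?g |- effective (fun x => ?g _) => apply (effective_comp _ _ H)
  | H : effective2 ?g |- effective (fun x => ?g _ _) => apply (effective_comp2 _ _ _ H)
  | H : effective3 ?g |- effective (fun x => ?g _ _ _) =>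
      apply (effective_comp3 _ _ _ _ H)
  | H : effective4 ?g |- effective (fun x => ?g _ _ _ _) =>
      apply (effective_comp4 _ _ _ _ _ H)
  | H : effective_pred ?g |- effective_pred (fun x => ?g _) =>
      apply (effective_comp _ _ H)
  | |- effective2 _ => first [assumption | unfold effective2]
  | |- effective3 _ => first [assumption | unfold effective3]
  | |- effective4 _ => first [assumption | unfold effective4]
  | |- effective_pred ?p =>
      first [assumption
            | lazymatch p with
              | fun x => _ =? _ => apply effective_eqb
              | fun x => negb _ => apply effective_neg
              | fun x => _ && _ => apply effective_and
              | fun x => forallb _ _ => apply effective_forallb
              | fun x => existsb _ _ => apply effective_existsb
              end]
  | |- effective ?f =>
      first
      [ assumption
      | lazymatch f with
        | fst => apply (effective_fst (fun x => x))
        | snd => apply (effective_snd (fun x => x))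
        | pi1 => apply (effective_pi1 (fun x => x))
        | pi2 => apply (effective_pi2 (fun x => x))
        | fun x => x => apply effective_id
        | fun x => (_, _) => apply effective_pair
        | fun x => fst _ => apply effective_fst
        | fun x => snd _ => apply effective_snd
        | fun x => S _ => apply effective_S
        | fun x => Nat.pred _ => apply effective_predecessor
        | fun x => _ + _ => apply effective_add
        | fun x => ⟨_, _⟩ => apply effective_to_nat
        | fun x => pi1 _ => apply effective_pi1
        | fun x => pi2 _ => apply effective_pi2
        | fun x => if _ then _ else _ => apply effective_if
        | fun x => _ :: _ => apply effective_cons
        | fun x => _ ++ _ => apply effective_app
        | fun x => seq 0 _ => apply effective_seq
        | fun x => length _ => apply effective_length
        | fun x => rev _ => apply effective_rev
        | fun x => last _ 0 => apply effective_last
        | fun x => removelast _ => apply effective_removelast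
        | fun x => enc _ => apply effective_enc
        | fun x => map _ _ => apply effective_map
        | fun x => flat_map _ _ => apply effective_flat_map
        | fun x => fold_right _ _ _ => apply effective_fold_right
        | fun x => nat_rect _ _ _ _ => apply effective_rect
        | fun x => ?c => apply effective_const
        end ]
  end.

Ltac effectivity := repeat (effectivity_step; cbv beta).

Fixpoint const_code (n : nat) : code :=
  match n with 0 => CZero | S m => CComp CSucc (const_code m) end.

Lemma eval_const_code n x : eval (const_code n) x n.
Proof. induction n as [|n IH]; cbn; eauto. Qed.

(* The s-m-n theorem for the enumeration [W]. *)
Lemma effective_enumeration (p : nat -> nat -> nat -> bool) :
  effective_pred (fun q => p (fst (fst q)) (snd (fst q)) (snd q)) ->
  exists f, computable f /\ forall x z, W (f x) z <-> exists n, p x z n = true.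
Proof.
  intros Hp. destruct (effective_neg _ Hp) as [c Hc]. cbn in Hc.
  set (inst x := CComp (CMu c) (CPair (const_code x) (CPair CFst CSnd))).
  exists (fun x => code_index (inst x)). split.
  - change (effective (fun x => code_index (inst x))).
    (* The constants are those of [code_index]: 5 for [CComp], 4 for [CPair], and 1 is the index of
       [CSucc]. [idx] follows the recursion of [const_code]. *)
    set (four n := (n + n) + (n + n)).
    set (idx x := nat_rect (fun _ => nat) 0 (fun _ r => 5 + four ⟨1, r⟩) x).
    set (u := code_index (CMu c)). set (v := code_index (CPair CFst CSnd)).
    apply (effective_ext (fun x => 5 + four ⟨u, 4 + four ⟨idx x, v⟩⟩)).
    { intros x. assert (E : code_index (const_code x) = idx x).
      { induction x as [|x IH]; [reflexivity|].
        change (code_index (const_code (S x)))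
          with (5 + 4 * ⟨1, code_index (const_code x)⟩).
        change (idx (S x)) with (5 + four ⟨1, idx x⟩).
        rewrite IH. unfold four. lia. }
      change (code_index (inst x))
        with (5 + 4 * ⟨u, 4 + 4 * ⟨code_index (const_code x), v⟩⟩).
      rewrite E. unfold four.
      replace (4 * ⟨idx x, v⟩) with (⟨idx x, v⟩ + ⟨idx x, v⟩ + (⟨idx x, v⟩ + ⟨idx x, v⟩)) by lia.
      lia. }
    assert (Hidx : effective idx) by (unfold idx, four; effectivity).
    assert (Hfour : effective four) by (unfold four; effectivity).
    effectivity.
  - intros x z.
    assert (Hin : eval (CPair (const_code x) (CPair CFst CSnd)) z ⟨x, z⟩).
    { cbn. exists x, z. split; [apply eval_const_code|]. split; [|reflexivity].
      exists (pi1 z), (pi2 z). now rewrite pair_pi. }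
    split.
    + intros (d & Ed & r & Hr). apply code_index_inj in Ed. subst d.
      destruct Hr as (m & Hm & H0 & _).
      rewrite (eval_functional _ _ _ _ Hm Hin) in H0.
      pose proof (eval_functional _ _ _ _ (Hc ((x, z), r)) H0) as E. cbn in E.
      exists r. now destruct (p x z r).
    + intros Hex. exists (inst x). split; [reflexivity|].
      destruct (epsilon_smallest (fun n => p x z n = true)) as [n [Hn Hmin]];
        [intros n; destruct (p x z n); auto|exact Hex|].
      exists n. exists ⟨x, z⟩. split; [exact Hin|]. cbn. split.
      * pose proof (Hc ((x, z), n)) as E. cbn in E. now rewrite Hn in E.
      * intros m L. exists 0. pose proof (Hc ((x, z), m)) as E. cbn in E.
        destruct (p x z m) eqn:Em; [|exact E]. specialize (Hmin _ Em). lia.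
Qed.

(** * The tree of stages *)

Definition count (p : nat -> bool) (n : nat) : nat :=
  nat_rect (fun _ => nat) 0 (fun u r => if p u then S r else r) n.

Lemma count_le p m n : m <= n -> count p m <= count p n.
Proof.
  induction 1 as [|n _ IH]; [lia|]. cbn. fold (count p n). destruct (p n); lia.
Qed.

Lemma count_lt p m n : m < n -> p m = true -> count p m < count p n.
Proof.
  intros L Hm. pose proof (count_le p (S m) n L) as C. cbn in C.
  rewrite Hm in C. fold (count p m) in C. lia.
Qed.

Lemma count_onto p n w : w < count p n -> exists u, u < n /\ p u = true /\ count p u = w.
Proof.
  induction n as [|n IH]; cbn; [lia|]. fold (count p n). intros L.
  destruct (p n) eqn:E.
  - destruct (Nat.eq_dec w (count p n)) as [->|N]; [now exists n; auto|].
    destruct IH as (u & Hu & H); [lia|]. exists u. split; [lia|exact H].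
  - destruct IH as (u & Hu & H); [lia|]. exists u. split; [lia|exact H].
Qed.

Lemma count_unbounded p w :
  (forall n, exists u, n <= u /\ p u = true) -> exists n, w < count p n.
Proof.
  intros Hinf. induction w as [|w [n IH]].
  - destruct (Hinf 0) as (u & _ & Hu). exists (S u).
    pose proof (count_lt p u (S u) ltac:(lia) Hu). lia.
  - destruct (Hinf n) as (u & L & Hu). exists (S u).
    pose proof (count_lt p u (S u) ltac:(lia) Hu).
    pose proof (count_le p n u L). lia.
Qed.

Lemma count_effective {A} `{encodable A} (p : A -> nat -> bool) (n : A -> nat) :
  effective_pred (fun q => p (fst q) (snd q)) -> effective n ->
  effective (fun a => count (fun u => p a u) (n a)).
Proof.
  intros Hp Hn. unfold count.
  apply (effective_rect n (fun _ => 0) (fun a u r => if p a u then S r else r));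
    [exact Hn|effectivity|].
  assert (Hp' : effective2 (fun a u => Nat.b2n (p a u))) by exact Hp.
  unfold effective3. apply effective_if; [|effectivity..].
  apply (effective_comp2 (fun a u => Nat.b2n (p a u))); effectivity.
Qed.

Definition prefix {A} (l m : list A) : Prop := exists t, m = l ++ t.

Section Tree.

Variable fire : nat -> nat -> bool.

(* The [v]-th visit to a node of level [k] goes on to a child: to child [0] when
   guess [k] fires, and otherwise to the child numbered by how often the guess
   has fired.  The latter is thus abandoned forever as soon as the guess fires
   again. *)
Definition outcome (k v : nat) : nat :=
  if fire k v then 0 else S (count (fire k) v).

(** The child's own visit number: the visits to each child are counted from 0 without gaps. *)
Definition clock (k v : nat) : nat :=
  count (fun u => outcome k u =? outcome k v) v.

(** Visit 0 stops at the node itself, and visit [S v'] becomes visit [clock k v'] of a child. Fuel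
    stands in for the decrease of the visit number, which is not structural. *)
Fixpoint descend (fuel k v : nat) : list nat :=
  match fuel, v with
  | S fuel', S v' => outcome k v' :: descend fuel' (S k) (clock k v')
  | _, _ => []
  end.

(* The node of level [k]'s subtree reached at its [v]-th visit.  A visit stops at
   the first node that it is the first to reach, so distinct stages [s] reach
   distinct nodes [node s]. *)
Definition subnode (k v : nat) : list nat := descend v k v.

Definition node (s : nat) : list nat := subnode 0 s.

Lemma clock_le k v : clock k v <= v.
Proof.
  unfold clock. generalize (fun u => outcome k u =? outcome k v). intros p.
  induction v as [|v IH]; cbn; [lia|]. fold (count p v). destruct (p v); lia.
Qed.

Lemma descend_fuel f f' k v : v <= f -> v <= f' -> descend f k v = descend f' k v.
Proof.
  revert f' k v. induction f as [|f IH]; intros [|f'] k [|v] L L'; cbn;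
    try lia; try reflexivity.
  f_equal. pose proof (clock_le k v). apply IH; lia.
Qed.

Lemma subnode_S k v : subnode k (S v) = outcome k v :: subnode (S k) (clock k v).
Proof.
  unfold subnode at 1. cbn. f_equal. apply descend_fuel; [apply clock_le|lia].
Qed.

Lemma clock_lt k u v : u < v -> outcome k u = outcome k v -> clock k u < clock k v.
Proof.
  intros L E. unfold clock. rewrite E. apply count_lt; [exact L|].
  now apply Nat.eqb_eq.
Qed.

Lemma clock_onto k v w :
  w <= clock k v -> exists u, u <= v /\ outcome k u = outcome k v /\ clock k u = w.
Proof.
  intros L. destruct (Nat.eq_dec w (clock k v)) as [->|N]; [now exists v|].
  destruct (count_onto (fun u => outcome k u =? outcome k v) v w) as (u & Hu & E & C).
  { unfold clock in *. lia. }
  apply Nat.eqb_eq in E. exists u. repeat split; [lia|exact E|].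
  unfold clock. now rewrite E.
Qed.

(** Two visits to the same child have different clocks, so they separate at the latest where one of
    them stops. *)
Lemma subnode_inj k u v : subnode k u = subnode k v -> u = v.
Proof.
  revert k v. induction u as [u IH] using lt_wf_ind. intros k v.
  destruct u as [|u], v as [|v]; rewrite ?subnode_S; try discriminate; [reflexivity|].
  intros E. injection E as Eo Ec. apply IH in Ec; [|pose proof (clock_le k u); lia].
  destruct (Nat.lt_trichotomy u v) as [L|[->|L]]; [|reflexivity|].
  - apply (clock_lt k) in L; [lia|exact Eo].
  - apply (clock_lt k) in L; [lia|now symmetry].
Qed.

(** Clocks skip no value, so visit 0 to each ancestor, the one that stops there, has already
    occurred. *)
Lemma subnode_prefix k v l :
  prefix l (subnode k v) -> exists u, u <= v /\ subnode k u = l.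
Proof.
  revert k v. induction l as [|o l IH]; intros k v [t E].
  { exists 0. split; [lia|reflexivity]. }
  destruct v as [|v]; [discriminate E|]. rewrite subnode_S in E.
  injection E as Eo E. destruct (IH (S k) (clock k v)) as (w & Hw & Ew).
  { now exists t. }
  destruct (clock_onto k v w Hw) as (u & Hu & Eu & Cu).
  exists (S u). split; [lia|]. rewrite subnode_S. congruence.
Qed.

(* Between two visits to the child that stands for a guess that no longer fires,
   its parent visits no other child. *)
Lemma outcome_noncrossing k q a r :
  q < a < r -> outcome k q = outcome k r -> outcome k q <> 0 ->
  outcome k a = outcome k q.
Proof.
  unfold outcome. intros L E N.
  destruct (fire k q) eqn:Fq; [congruence|]. destruct (fire k r); [congruence|].
  injection E as E.
  pose proof (count_le (fire k) q a ltac:(lia)).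
  destruct (fire k a) eqn:Fa.
  - pose proof (count_lt (fire k) a r ltac:(lia) Fa). lia.
  - pose proof (count_le (fire k) a r ltac:(lia)). f_equal. lia.
Qed.

(** Where [q] and [a] part, at most one of them takes outcome 0, the only outcome that can be
    interrupted and resumed. If it is [q], the visits [a] and [t] enclose [r] and force [r] into the
    child of [a]; otherwise [q] and [r] enclose [a]. *)
Lemma subnode_noncrossing k q a r t :
  q < a -> a < r -> r <= t ->
  prefix (subnode k q) (subnode k r) -> prefix (subnode k a) (subnode k t) ->
  prefix (subnode k q) (subnode k a).
Proof.
  revert k a r t. induction q as [q IH] using lt_wf_ind.
  intros k a r t Hqa Har Hrt [l El] [m Em].
  destruct q as [|q]; [now exists (subnode k a)|].
  destruct a as [|a]; [lia|]. destruct r as [|r]; [lia|]. destruct t as [|t]; [lia|].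
  rewrite !subnode_S in *. injection El as Eqr El. injection Em as Eat Em.
  destruct (Nat.eq_dec (outcome k q) (outcome k a)) as [E|N].
  - destruct (IH (clock k q) ltac:(pose proof (clock_le k q); lia)
      (S k) (clock k a) (clock k r) (clock k t)) as [p Ep].
    + apply clock_lt; [lia|congruence].
    + apply clock_lt; [lia|congruence].
    + destruct (Nat.eq_dec r t) as [->|Nt]; [lia|].
      apply Nat.lt_le_incl, clock_lt; [lia|congruence].
    + now exists l.
    + now exists m.
    + exists p. cbn. congruence.
  - exfalso. destruct (Nat.eq_dec r t) as [->|Nt]; [congruence|].
    destruct (Nat.eq_dec (outcome k q) 0) as [Z|NZ].
    + apply N. rewrite <- Eqr. apply (outcome_noncrossing k a r t); [lia|congruence..].
    + apply N. symmetry. apply (outcome_noncrossing k q a r); [lia|congruence..].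
Qed.

(** * The true path *)

Definition recurs (k : nat) : Prop := forall n, exists v, n <= v /\ fire k v = true.

(** If the guess falls silent from visit [n] on, its count is constant from there, and every later
    visit goes to the child carrying that count. *)
Lemma outcome_recurs k : exists o, (o = 0 <-> recurs k) /\
  forall w, exists v, outcome k v = o /\ clock k v = w.
Proof.
  assert (Honto : forall o, (forall n, exists v, n <= v /\ outcome k v = o) ->
    forall w, exists v, outcome k v = o /\ clock k v = w).
  { intros o Ho w.
    destruct (count_unbounded (fun u => outcome k u =? o) w) as [n Hn].
    { intros n. destruct (Ho n) as (v & L & E). exists v.
      split; [exact L|]. now apply Nat.eqb_eq. }
    apply count_onto in Hn as (u & _ & E & C). apply Nat.eqb_eq in E.
    exists u. split; [exact E|]. unfold clock. now rewrite E. }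
  destruct (classic (recurs k)) as [R|NR].
  - exists 0. split; [tauto|]. apply Honto. intros n.
    destruct (R n) as (v & L & F). exists v. split; [exact L|].
    unfold outcome. now rewrite F.
  - assert (Hn : exists n, forall v, n <= v -> fire k v = false).
    { apply NNPP. intros Hno. apply NR. intros n. apply NNPP. intros Hv.
      apply Hno. exists n. intros v L. destruct (fire k v) eqn:F; [|reflexivity].
      exfalso. eauto. }
    destruct Hn as [n Hn]. exists (S (count (fire k) n)). split.
    { split; [discriminate|tauto]. }
    apply Honto. intros m. exists (n + m). split; [lia|].
    unfold outcome. rewrite Hn by lia. f_equal.
    induction m as [|m IH]; [now rewrite Nat.add_0_r|].
    rewrite Nat.add_succ_r. cbn. fold (count (fire k) (n + m)).
    now rewrite Hn by lia.
Qed.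

(** The lower part of the path is taken from the next level; since the right child attains every
    clock value, each late visit below is the continuation of some visit here. *)
Lemma subnode_true_path m k : exists l, length l = m /\
  (forall i, i < m -> (nth i l 0 = 0 <-> recurs (k + i))) /\
  forall w, exists v, w <= v /\ subnode k v = l ++ subnode (k + m) w.
Proof.
  revert k. induction m as [|m IH]; intros k.
  { exists []. repeat split; [lia|lia|]. intros w. exists w.
    now rewrite Nat.add_0_r. }
  destruct (outcome_recurs k) as (o & Ho & Hv).
  destruct (IH (S k)) as (l & Hl & Hr & Hw).
  exists (o :: l). split; [cbn; lia|]. split.
  - intros [|i] L; cbn; [now rewrite Nat.add_0_r|].
    rewrite Nat.add_succ_r. apply Hr. lia.
  - intros w. destruct (Hw w) as (v' & L & E'). destruct (Hv v') as (v & Eo & Ec).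
    exists (S v). split; [pose proof (clock_le k v); lia|].
    rewrite subnode_S, Eo, Ec, E'. cbn. now rewrite Nat.add_succ_r.
Qed.

Definition anc (a s : nat) : Prop := prefix (node a) (node s).

Lemma anc_refl a : anc a a.
Proof. exists []. now rewrite app_nil_r. Qed.

Lemma anc_le a s : anc a s -> a <= s.
Proof.
  intros H. apply subnode_prefix in H as (u & L & E). apply subnode_inj in E. lia.
Qed.

Lemma node_parent s : 0 < s -> exists p o, p < s /\ node s = node p ++ [o].
Proof.
  intros Hs. destruct (exists_last (l := node s)) as (l & o & E).
  { unfold node. destruct s as [|s]; [lia|]. rewrite subnode_S. discriminate. }
  destruct (subnode_prefix 0 s l) as (p & L & Ep); [now exists [o]|].
  exists p, o. split; [|unfold node at 2; now rewrite Ep].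
  destruct (Nat.eq_dec p s) as [->|N]; [|lia].
  unfold node in E. rewrite E in Ep. apply (f_equal (@length _)) in Ep.
  rewrite length_app in Ep. cbn in Ep. lia.
Qed.

Lemma anc_parent a s p o : node s = node p ++ [o] -> anc a s -> a = s \/ anc a p.
Proof.
  intros E [t Et]. rewrite E in Et.
  destruct t as [|x t].
  - left. apply (subnode_inj 0). change (node a = node s). rewrite app_nil_r in Et.
    congruence.
  - right. destruct (exists_last (l := x :: t)) as (u & y & Eu); [discriminate|].
    rewrite Eu, app_assoc in Et. apply app_inj_tail in Et as [Et _]. now exists u.
Qed.

Lemma anc_noncrossing q a r t :
  q <= a -> a <= r -> r <= t -> anc q r -> anc a t -> anc q a.
Proof.
  intros Hqa Har Hrt Hq Ha.
  destruct (Nat.eq_dec q a) as [->|N]; [apply anc_refl|].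
  destruct (Nat.eq_dec a r) as [->|N']; [exact Hq|].
  apply (subnode_noncrossing 0 q a r t); [lia..|exact Hq|exact Ha].
Qed.

(** Each level uses up at least one visit. This keeps the indices [X k] and [Y k] of a node below
    its stage. *)
Lemma node_length s : length (node s) <= s.
Proof.
  unfold node. generalize 0. induction s as [s IH] using lt_wf_ind. intros k.
  destruct s as [|s]; [cbn; lia|]. rewrite subnode_S. cbn.
  pose proof (clock_le k s). specialize (IH (clock k s) ltac:(lia) (S k)). lia.
Qed.

Lemma node_true_path m : exists a, length (node a) = m /\
  (forall i, i < m -> (nth i (node a) 0 = 0 <-> recurs i)) /\
  forall n, exists s, n <= s /\ anc a s.
Proof.
  destruct (subnode_true_path m 0) as (l & Hl & Hr & Hv).
  destruct (Hv 0) as (a & _ & Ea). cbn in Ea. rewrite app_nil_r in Ea.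
  exists a. unfold anc, node. rewrite Ea.
  split; [exact Hl|]. split; [exact Hr|].
  intros n. destruct (Hv n) as (s & L & Es). exists s. split; [exact L|].
  rewrite Es. now eexists.
Qed.

Hypothesis fire_effective : effective_pred (fun q => fire (fst q) (snd q)).

Lemma outcome_effective : effective2 outcome.
Proof.
  unfold effective2, outcome.
  apply effective_if; [assumption|effectivity|].
  apply effective_S, (count_effective (fun q u => fire (fst q) u)); [|effectivity].
  apply (effective_comp2 (fun k u => Nat.b2n (fire k u))); effectivity.
Qed.

Lemma clock_effective : effective2 clock.
Proof.
  pose proof outcome_effective. unfold effective2, clock.
  apply (count_effective (fun q u => outcome (fst q) u =? outcome (fst q) (snd q)));
    effectivity.
Qed.

(** [descend] changes its parameters at every call, so it is run as a loop on triples of level,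
    visit number and reversed path, idle once the visit number is 0. *)
Lemma node_effective : effective node.
Proof.
  set (step (q : nat * (nat * list nat)) :=
    if fst (snd q) =? 0 then q
    else (S (fst q), (clock (fst q) (Nat.pred (fst (snd q))),
      outcome (fst q) (Nat.pred (fst (snd q))) :: snd (snd q)))).
  set (loop n q := nat_rect (fun _ => (nat * (nat * list nat))%type) q
    (fun _ r => step r) n).
  assert (Hloop : forall n k v l, v <= n ->
    snd (snd (loop n (k, (v, l)))) = rev (subnode k v) ++ l).
  { assert (Hcomm : forall n q, loop (S n) q = loop n (step q)).
    { intros n q. induction n as [|n IH]; [reflexivity|].
      change (step (loop (S n) q) = step (loop n (step q))). now rewrite IH. }
    induction n as [|n IH]; intros k v l L.
    { now replace v with 0 by lia. }
    rewrite Hcomm. destruct v as [|v].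
    - change (step (k, (0, l))) with (k, (0, l)). rewrite IH by lia. reflexivity.
    - change (step (k, (S v, l))) with (S k, (clock k v, outcome k v :: l)).
      rewrite IH by (pose proof (clock_le k v); lia).
      rewrite subnode_S. cbn. now rewrite <- app_assoc. }
  apply (effective_ext (fun s => rev (snd (snd (loop s (0, (s, []))))))).
  { intros s. rewrite Hloop by lia. now rewrite app_nil_r, rev_involutive. }
  pose proof outcome_effective. pose proof clock_effective.
  unfold loop, step. effectivity.
Qed.

End Tree.

(** * The construction *)

Section Construction.

Variables (act mul : nat -> nat -> nat) (inv : nat -> nat) (one o : nat).

Hypothesis act_one : forall z, act one z = z.
Hypothesis act_mul : forall a b z, act (mul a b) z = act a (act b z).
Hypothesis act_invl : forall a z, act (inv a) (act a z) = z.
Hypothesis act_invr : forall a z, act a (act (inv a) z) = z.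

Lemma act_inj a z w : act a z = act a w -> z = w.
Proof. intros E. now rewrite <- (act_invl a z), E, act_invl. Qed.

(** Throughout, a group element [c] stands for the point [act c o] of the infinite orbit, so that
    the bookkeeping takes place in the group. *)
Definition separates (k : nat) (C T : list nat) : Prop :=
  forall c t, In c C -> In t T -> act k (act c o) <> act t o.

(* P. M. Neumann's separation lemma.  If [k] separates the tail of [C] from an
   enlarged [T] but sends [c] to the point of [e] in [T], then multiplying [k]
   by an element that carries that point to one outside [T] repairs it. *)
Lemma separation :
  (forall T, exists b, forall t, In t T -> act b o <> act t o) ->
  forall C T, exists k, separates k C T.
Proof.
  intros Hinf C. induction C as [|c C IH]; intros T.
  { exists one. now intros c t []. }
  destruct (Hinf T) as [b Hb].
  (* The added elements are e b⁻¹ t: after multiplication by b e⁻¹, an image of the tail hits the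
     point of t exactly if it hit that of e b⁻¹ t before. *)
  destruct (IH (T ++ flat_map (fun e => map (mul (mul e (inv b))) T) T)) as [k Hk].
  destruct (classic (exists e, In e T /\ act k (act c o) = act e o)) as [(e & He & E)|N].
  - exists (mul (mul b (inv e)) k). intros c' t [<-|Hc] Ht; rewrite !act_mul.
    + rewrite E, act_invl. now apply Hb.
    + intros E'. apply (Hk c' (mul (mul e (inv b)) t) Hc).
      * apply in_or_app. right. apply in_flat_map. exists e. split; [exact He|].
        now apply in_map.
      * now rewrite !act_mul, <- E', act_invl, act_invr.
  - exists k. intros c' t [<-|Hc] Ht.
    + eauto.
    + apply Hk; [exact Hc|]. apply in_or_app. now left.
Qed.

(* A list of mergers, latest first: [(i, (j, k))] gives the members of class [j]
   the label [i] and multiplies their positions by [k]. *)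
Definition mergers : Type := list (nat * (nat * nat)).

Definition place (N : mergers) (x : nat) : nat * nat :=
  fold_right (fun e q => if fst q =? fst (snd e)
    then (fst e, mul (snd q) (snd (snd e))) else q) (x, one) N.

Definition label (N : mergers) (x : nat) : nat := fst (place N x).
Definition position (N : mergers) (x : nat) : nat := snd (place N x).

Definition move (N : mergers) (x y c : nat) : nat :=
  mul (position N x) (mul (inv (position N y)) c).

(** The map h_x h_y⁻¹ on numbers; [move] is the same map on the group elements naming them. *)
Definition transport (N : mergers) (x y z : nat) : nat :=
  act (position N x) (act (inv (position N y)) z).

Lemma act_move N x y c z : act (move N x y c) z = transport N x y (act c z).
Proof. unfold move, transport. now rewrite !act_mul. Qed.

Lemma transport_refl N x z : transport N x x z = z.
Proof. apply act_invr. Qed.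

Lemma transport_trans N x y w z :
  transport N x y (transport N y w z) = transport N x w z.
Proof. unfold transport. now rewrite act_invl. Qed.

Lemma place_cons i j k N x :
  label ((i, (j, k)) :: N) x = (if label N x =? j then i else label N x) /\
  position ((i, (j, k)) :: N) x =
    (if label N x =? j then mul (position N x) k else position N x).
Proof.
  unfold label, position. cbn. destruct (fst _ =? j); now split.
Qed.

Lemma act_inv_mul a b z : act (inv (mul a b)) z = act (inv b) (act (inv a) z).
Proof.
  apply (act_inj (mul a b)). now rewrite act_invr, act_mul, !act_invr.
Qed.

(** If both positions are multiplied by k, the factors cancel in h_x k k⁻¹ h_y⁻¹. *)
Lemma merge_persists e N x y :
  label N x = label N y -> label (e :: N) x = label (e :: N) y /\
  forall z, transport (e :: N) x y z = transport N x y z.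
Proof.
  destruct e as [i [j k]]. intros E. unfold transport.
  destruct (place_cons i j k N x) as [-> ->], (place_cons i j k N y) as [-> ->].
  rewrite E. split; [reflexivity|]. intros z.
  destruct (label N y =? j); [|reflexivity].
  now rewrite act_inv_mul, act_mul, act_invr.
Qed.

(** Exactly one of [x] and [y] has label [j]; which one decides between k and its inverse. *)
Lemma merge_new i j k N x y :
  label N x <> label N y ->
  label ((i, (j, k)) :: N) x = label ((i, (j, k)) :: N) y ->
  (forall z, transport ((i, (j, k)) :: N) x y z =
     act (position N x) (act k (act (inv (position N y)) z))) \/
  (forall z, transport ((i, (j, k)) :: N) x y z =
     act (position N x) (act (inv k) (act (inv (position N y)) z))).
Proof.
  intros D E. unfold transport.
  destruct (place_cons i j k N x) as [Ex ->], (place_cons i j k N y) as [Ey ->].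
  rewrite Ex, Ey in E.
  destruct (Nat.eqb_spec (label N x) j) as [Hx|Hx],
    (Nat.eqb_spec (label N y) j) as [Hy|Hy]; try congruence.
  - left. intros z. now rewrite act_mul.
  - right. intros z. now rewrite act_inv_mul.
Qed.

(** * The stages of the enumeration *)

Variable fire : nat -> nat -> bool.
Variables X Y Z : nat -> nat.
Hypothesis X_le : forall k, X k <= k.
Hypothesis Y_le : forall k, Y k <= k.

Variable find : list nat -> list nat -> nat.
Hypothesis find_separates : forall C T, separates (find C T) C T.

(** The marks seen through h_x⁻¹ for every index at once. A join acts as h_x k h_y⁻¹, so one k
    moving this set off itself serves all pairs of indices. *)
Definition pulled (s : nat) (N : mergers) (M : list nat) : list nat :=
  flat_map (fun x => map (fun c => mul (inv (position N x)) c) M) (seq 0 (S s)).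

(** The second half serves the diagonalisation: if g and h_X⁻¹ Z h_Y q sent [o] to the same point,
    then the witness h_X g, pulled back by Z, would give a number h_Y q that old elements may
    already supply. *)
Definition targets (k : nat) (N : mergers) (Q : list nat) : list nat :=
  Q ++ map (fun q => mul (inv (position N (X k))) (mul (Z k) (mul (position N (Y k)) q))) Q.

(** The same element serves as the multiplier of a join or as the seed of a witness; [one] is
    included on the left so that the point of g itself avoids the targets. *)
Definition fresh (s k : nat) (N : mergers) (M : list nat) : nat :=
  find (one :: pulled s N M) (targets k N (pulled s N M)).

Definition extend (k b g : nat) (N : mergers) : mergers :=
  if b =? 0 then (label N (X k), (label N (Y k), g)) :: N else N.

Definition witness (k g : nat) (N : mergers) : nat := mul (position N (X k)) g.

Definition seeded (k b w : nat) (A : list (nat * nat)) : list (nat * nat) :=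
  if b =? 0 then A else (X k, w) :: A.

Definition spread (s : nat) (N : mergers) (A : list (nat * nat)) : list (nat * nat) :=
  flat_map (fun e => flat_map (fun x =>
    if label N x =? label N (fst e) then [(x, move N x (fst e) (snd e))] else [])
    (seq 0 (S s))) A.

(** The first entry names the number that a diagonalising node wants to keep out of the set of
    [Y k]. *)
Definition base (k w : nat) (A : list (nat * nat)) (M : list nat) : list nat :=
  mul (inv (Z k)) w :: M ++ map snd A.

Definition saturate (s : nat) (N : mergers) (B : list nat) : list nat :=
  flat_map (fun x => flat_map (fun y => map (fun c => move N x y c) B)
    (seq 0 (S s))) (seq 0 (S s)).

Definition history : Type := list (list nat * mergers).

Definition lookup (l : list nat) (H : history) : mergers :=
  fold_right (fun e r => if enc (fst e) =? enc l then snd e else r) [] H.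

(* The elements enumerated so far, [(x, c)] putting the point [act c o] into the
   set of [x]; the elements that later stages must avoid; the mergers of all nodes
   reached so far. *)
Definition state : Type := list (nat * nat) * (list nat * history).

Definition parent_mergers (l : list nat) (H : history) : mergers :=
  lookup (removelast l) H.

Definition stage (s : nat) (st : state) : state :=
  let l := node fire s in
  let k := Nat.pred (length l) in
  let b := last l 0 in
  let A := fst st in
  let M := fst (snd st) in
  let H := snd (snd st) in
  let P := parent_mergers l H in
  let g := fresh s k P M in
  let N := extend k b g P in
  let w := witness k g P in
  let A' := spread s N (seeded k b w A) in
  (A', (saturate s N (base k w A' M), (l, N) :: H)).

(** Stage 0 belongs to the root, recorded with no mergers; action begins at stage 1. *)
Definition run (n : nat) : state :=
  nat_rect (fun _ => state) ([], ([], [([], [])])) (fun n st => stage (S n) st) n.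

Definition elts (n : nat) : list (nat * nat) := fst (run n).
Definition marked (n : nat) : list nat := fst (snd (run n)).
Definition past (n : nat) : history := snd (snd (run n)).
Definition merged (n : nat) : mergers := lookup (node fire n) (past n).

Definition mem (n x z : nat) : Prop := exists c, In (x, c) (elts n) /\ act c o = z.

Lemma lookup_cons l N H m :
  lookup m ((l, N) :: H) = if enc l =? enc m then N else lookup m H.
Proof. reflexivity. Qed.

(** Distinct stages reach distinct nodes, so a recorded entry is never overwritten. *)
Lemma past_merged n p : p <= n -> lookup (node fire p) (past n) = merged p.
Proof.
  induction n as [|n IH]; intros L.
  { now replace p with 0 by lia. }
  destruct (Nat.eq_dec p (S n)) as [->|N]; [reflexivity|].
  rewrite <- IH by lia. unfold past at 1, run. cbn [nat_rect]. fold (run n).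
  unfold stage. cbn [snd]. rewrite lookup_cons.
  destruct (Nat.eqb_spec (enc (node fire (S n))) (enc (node fire p))) as [E|_];
    [|reflexivity].
  apply enc_inj, subnode_inj in E. lia.
Qed.

(** The parent node was reached at an earlier stage [p], and what [lookup] retrieves for it is
    [merged p]. *)
Lemma stage_spec n : exists p b g,
  let k := length (node fire p) in
  let N := merged (S n) in
  p <= n /\ node fire (S n) = node fire p ++ [b] /\
  separates g (one :: pulled (S n) (merged p) (marked n))
    (targets k (merged p) (pulled (S n) (merged p) (marked n))) /\
  N = extend k b g (merged p) /\
  elts (S n) = spread (S n) N (seeded k b (witness k g (merged p)) (elts n)) /\
  marked (S n) = saturate (S n) N (base k (witness k g (merged p)) (elts (S n)) (marked n)).
Proof.
  destruct (node_parent fire (S n)) as (p & b & L & E); [lia|].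
  exists p, b, (fresh (S n) (length (node fire p)) (merged p) (marked n)).
  cbn zeta.
  assert (Ek : Nat.pred (length (node fire (S n))) = length (node fire p)).
  { rewrite E, length_app. cbn. lia. }
  assert (Eb : last (node fire (S n)) 0 = b) by (rewrite E; apply last_last).
  assert (Ep : parent_mergers (node fire (S n)) (past n) = merged p).
  { unfold parent_mergers. rewrite E, removelast_last. apply past_merged. lia. }
  assert (ER : run (S n) = stage (S n) (run n)) by reflexivity.
  unfold stage in ER. fold (elts n) (marked n) (past n) in ER.
  rewrite Ek, Eb, Ep in ER.
  assert (EN : merged (S n) = extend (length (node fire p)) b
    (fresh (S n) (length (node fire p)) (merged p) (marked n)) (merged p)).
  { unfold merged at 1, past. rewrite ER. cbn [snd]. rewrite lookup_cons.
    now rewrite Nat.eqb_refl. }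
  split; [lia|]. split; [exact E|]. split; [apply find_separates|].
  split; [exact EN|].
  assert (EA : elts (S n) = spread (S n) (merged (S n)) (seeded (length (node fire p)) b
    (witness (length (node fire p)) (fresh (S n) (length (node fire p)) (merged p)
      (marked n)) (merged p)) (elts n))).
  { unfold elts at 1. rewrite ER. cbn [fst]. now rewrite EN. }
  split; [exact EA|].
  unfold marked at 1. rewrite ER. cbn [fst snd]. rewrite EA, EN. reflexivity.
Qed.

(** * Members, marks and the indices they involve *)

Definition pts (L : list nat) (z : nat) : Prop := exists c, In c L /\ act c o = z.

Lemma in_pulled s N M x c :
  x <= s -> In c M -> In (mul (inv (position N x)) c) (pulled s N M).
Proof.
  intros L Hc. apply in_flat_map. exists x. split; [apply in_seq; lia|].
  now apply (in_map (fun c => mul (inv (position N x)) c)).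
Qed.

Lemma in_spread s N A x c :
  In (x, c) (spread s N A) <-> exists y d, In (y, d) A /\ x <= s /\
    label N x = label N y /\ c = move N x y d.
Proof.
  unfold spread. rewrite in_flat_map. split.
  - intros ([y d] & Hd & H). apply in_flat_map in H as (x' & Hx' & H). cbn in H.
    destruct (Nat.eqb_spec (label N x') (label N y)) as [E|]; [|now destruct H].
    destruct H as [H|[]]. injection H as -> <-. apply in_seq in Hx'.
    exists y, d. repeat split; [exact Hd|lia|exact E].
  - intros (y & d & Hd & L & E & ->). exists (y, d). split; [exact Hd|].
    apply in_flat_map. exists x. split; [apply in_seq; lia|]. cbn.
    rewrite E, Nat.eqb_refl. now left.
Qed.

Lemma in_saturate s N B x y c :
  x <= s -> y <= s -> In c B -> In (move N x y c) (saturate s N B).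
Proof.
  intros Lx Ly Hc. apply in_flat_map. exists x. split; [apply in_seq; lia|].
  apply in_flat_map. exists y. split; [apply in_seq; lia|].
  now apply (in_map (fun c => move N x y c)).
Qed.

Lemma stage_mergers n : exists p b g,
  let k := length (node fire p) in
  p <= n /\ node fire (S n) = node fire p ++ [b] /\
  merged (S n) = extend k b g (merged p).
Proof.
  destruct (stage_spec n) as (p & b & g & L & E & _ & EN & _). now exists p, b, g.
Qed.

(** All joins in [merged s] concern levels below [s], hence indices below [s]. *)
Lemma label_bound s x :
  (s <= x -> label (merged s) x = x) /\ (x < s -> label (merged s) x < s).
Proof.
  revert x. induction s as [s IH] using lt_wf_ind. intros x.
  destruct s as [|n]; [cbn; lia|].
  destruct (stage_mergers n) as (p & b & g & L & E & EN).
  assert (Lk : length (node fire p) <= p) by apply node_length.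
  pose proof (X_le (length (node fire p))) as LX.
  pose proof (Y_le (length (node fire p))) as LY.
  pose proof (IH p ltac:(lia) x) as (Hx & Hx').
  rewrite EN. unfold extend. destruct (b =? 0).
  - destruct (place_cons (label (merged p) (X (length (node fire p))))
      (label (merged p) (Y (length (node fire p)))) g (merged p) x) as [-> _].
    pose proof (IH p ltac:(lia) (X (length (node fire p)))) as (HX & HX').
    pose proof (IH p ltac:(lia) (Y (length (node fire p)))) as (HY & HY').
    destruct (Nat.eqb_spec (label (merged p) x)
      (label (merged p) (Y (length (node fire p))))) as [Ex|_].
    + lia.
    + lia.
  - lia.
Qed.

(** Justifies letting [spread] and [saturate] range over the indices up to [s] only: no larger index
    lies in a nontrivial class. *)
Lemma class_bound s x y :
  label (merged s) x = label (merged s) y -> x <> y -> x <= s.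
Proof.
  intros E N. destruct (Nat.le_gt_cases x s) as [|L]; [assumption|].
  destruct (label_bound s x) as (Hx & _), (label_bound s y) as (Hy & Hy').
  rewrite Hx in E by lia.
  destruct (Nat.le_gt_cases s y) as [L'|L'].
  - rewrite Hy in E by lia. congruence.
  - specialize (Hy' L'). lia.
Qed.

Lemma mem_bound n x z : mem n x z -> x <= n.
Proof.
  intros (c & Hc & _). destruct n as [|n]; [destruct Hc|].
  destruct (stage_spec n) as (p & b & g & _ & _ & _ & _ & EA & _).
  rewrite EA in Hc. apply in_spread in Hc as (y & d & _ & L & _). exact L.
Qed.

Lemma seeded_incl k b w A e : In e A -> In e (seeded k b w A).
Proof. intros H. unfold seeded. destruct (b =? 0); [exact H|now right]. Qed.

Lemma mem_step n x y z :
  label (merged (S n)) x = label (merged (S n)) y -> mem n y z ->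
  mem (S n) x (transport (merged (S n)) x y z).
Proof.
  intros E Hz. pose proof (mem_bound _ _ _ Hz) as Ly. destruct Hz as (c & Hc & Ec).
  destruct (stage_spec n) as (p & b & g & _ & _ & _ & _ & EA & _).
  exists (move (merged (S n)) x y c). split.
  - rewrite EA. apply in_spread. exists y, c. split; [now apply seeded_incl|].
    repeat split; [|exact E].
    destruct (Nat.eq_dec x y) as [->|N]; [lia|]. exact (class_bound _ _ _ E N).
  - now rewrite act_move, Ec.
Qed.

Lemma mem_S n x z : mem n x z -> mem (S n) x z.
Proof.
  intros H. rewrite <- (transport_refl (merged (S n)) x z). now apply mem_step.
Qed.

Lemma mem_mono m n x z : m <= n -> mem m x z -> mem n x z.
Proof. induction 1; intros; [assumption|]. apply mem_S. auto. Qed.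

(** [spread] has just copied each element to the whole class of its source, and transports
    compose. *)
Lemma mem_consistent s x y z :
  label (merged s) x = label (merged s) y -> mem s y z ->
  mem s x (transport (merged s) x y z).
Proof.
  destruct s as [|n]; intros E (c & Hc & Ec); [destruct Hc|].
  destruct (stage_spec n) as (p & b & g & _ & _ & _ & _ & EA & _).
  destruct (Nat.eq_dec x y) as [->|N].
  { rewrite transport_refl. now exists c. }
  rewrite EA in Hc. apply in_spread in Hc as (y' & d & Hd & _ & E' & ->).
  exists (move (merged (S n)) x y' d). split.
  - rewrite EA. apply in_spread. exists y', d. repeat split; [exact Hd| |congruence].
    exact (class_bound _ _ _ E N).
  - rewrite <- Ec, !act_move. now rewrite transport_trans.
Qed.

Lemma mem_marked n x z : mem n x z -> pts (marked n) z.
Proof.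
  intros (c & Hc & <-). destruct n as [|n]; [destruct Hc|].
  destruct (stage_spec n) as (p & b & g & _ & _ & _ & _ & _ & EM).
  exists (move (merged (S n)) 0 0 c). split; [|now rewrite act_move, transport_refl].
  rewrite EM. apply in_saturate; [lia..|]. right. apply in_or_app. right.
  change c with (snd (x, c)). now apply in_map.
Qed.

(** A mark stable under the node's own identifications, so that an induction may pass from one index
    of a class to another without losing it. *)
Definition guarded (a w : nat) : Prop :=
  forall x y, label (merged a) x = label (merged a) y ->
  pts (marked a) (transport (merged a) y x w).

Lemma guarded_saturate s B w :
  marked s = saturate s (merged s) B -> pts B w -> guarded s w.
Proof.
  intros EM (c & Hc & <-) x y E. destruct (Nat.eq_dec x y) as [->|N].
  - exists (move (merged s) 0 0 c). rewrite act_move, !transport_refl.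
    split; [|reflexivity]. rewrite EM. apply in_saturate; [lia..|exact Hc].
  - exists (move (merged s) y x c). rewrite act_move. split; [|reflexivity].
    rewrite EM. apply in_saturate; [..|exact Hc].
    + apply (class_bound s y x); congruence.
    + apply (class_bound s x y); congruence.
Qed.

Lemma guarded_S n w : pts (marked n) w -> guarded (S n) w.
Proof.
  intros (c & Hc & Ec). destruct (stage_spec n) as (p & b & g & _ & _ & _ & _ & _ & EM).
  apply (guarded_saturate _ _ _ EM). exists c. split; [|exact Ec].
  right. apply in_or_app. now left.
Qed.

Lemma guarded_marked a w : guarded a w -> pts (marked a) w.
Proof. intros H. rewrite <- (transport_refl (merged a) 0 w). now apply H. Qed.

Lemma marked_mono m n w : m <= n -> pts (marked m) w -> pts (marked n) w.
Proof.
  induction 1; intros; [assumption|]. apply guarded_marked, guarded_S. auto.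
Qed.

Lemma marked_guarded a q w : a < q -> pts (marked a) w -> guarded q w.
Proof.
  intros L H. destruct q as [|q]; [lia|]. apply guarded_S, (marked_mono a); [lia|exact H].
Qed.

(** Applying h_x⁻¹ turns either coincidence into one between the g-image of an element of
    [one :: pulled] and an element of [pulled]. The first inequality protects marks against a new
    join, the second against a new seed. *)
Lemma separates_pulled s k g N M x y z w :
  separates g (one :: pulled s N M) (targets k N (pulled s N M)) ->
  x <= s -> y <= s -> pts M z -> pts M w ->
  act (position N x) (act g (act (inv (position N y)) z)) <> w /\
  act (position N x) (act g o) <> w.
Proof.
  intros Hg Lx Ly (c & Hc & <-) (d & Hd & <-).
  assert (Hx : In (mul (inv (position N x)) d) (targets k N (pulled s N M))).
  { apply in_or_app. left. now apply in_pulled. }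
  split; intros E; apply (f_equal (act (inv (position N x)))) in E;
    rewrite act_invl in E.
  - refine (Hg (mul (inv (position N y)) c) _ _ Hx _).
    + right. now apply in_pulled.
    + now rewrite !act_mul.
  - refine (Hg one _ _ Hx _); [now left|]. now rewrite act_one, act_mul.
Qed.

(** * Joins along a branch, and restraint *)

Lemma anc_persists a s x y :
  anc fire a s -> label (merged a) x = label (merged a) y ->
  label (merged s) x = label (merged s) y /\
  forall z, transport (merged s) x y z = transport (merged a) x y z.
Proof.
  intros Ha E. revert Ha. induction s as [s IH] using lt_wf_ind. intros Ha.
  destruct (Nat.eq_dec a s) as [->|N]; [now split|].
  destruct s as [|n]; [apply anc_le in Ha; lia|].
  destruct (stage_mergers n) as (p & b & g & L & En & EN).
  destruct (anc_parent fire _ _ _ _ En Ha) as [->|Hp]; [now split|].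
  destruct (IH p ltac:(lia) Hp) as [El Et].
  rewrite EN. unfold extend. destruct (b =? 0); [|now split].
  destruct (merge_persists (label (merged p) (X (length (node fire p))),
    (label (merged p) (Y (length (node fire p))), g)) _ _ _ El) as [El' Et'].
  split; [exact El'|]. intros z. now rewrite Et'.
Qed.

(** Members are marked, so both ends of an offending transport would be marks. If the join uses g⁻¹,
    the argument is applied to the reversed pair, since g would then carry one mark back to the
    other. *)
Lemma join_unmarked n p b x y z :
  node fire (S n) = node fire p ++ [b] ->
  label (merged p) x <> label (merged p) y ->
  label (merged (S n)) x = label (merged (S n)) y ->
  mem n y z -> ~ pts (marked n) (transport (merged (S n)) x y z).
Proof.
  intros En D E Hz Hw.
  destruct (stage_spec n) as (p' & b' & g & L & En' & Hg & EN & _).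
  rewrite En in En'. apply app_inj_tail in En' as [Ep <-].
  apply subnode_inj in Ep. subst p'. rename L into Lp.
  assert (Nxy : x <> y) by congruence.
  pose proof (class_bound _ _ _ E Nxy) as Lx.
  pose proof (class_bound _ _ _ (eq_sym E) (not_eq_sym Nxy)) as Ly.
  rewrite EN in E, Hw. unfold extend in E, Hw. destruct (b =? 0); [|contradiction].
  pose proof (mem_marked _ _ _ Hz) as Hz'.
  destruct (merge_new _ _ _ _ _ _ D E) as [Et|Et]; rewrite Et in Hw.
  - exact (proj1 (separates_pulled _ _ _ _ _ x y z _ Hg Lx Ly Hz' Hw) eq_refl).
  - apply (proj1 (separates_pulled _ _ _ _ _ y x _ z Hg Ly Lx Hw Hz')).
    now rewrite act_invl, !act_invr.
Qed.

(** Every identification at a node goes back to the one ancestor that introduced it, and later joins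
    do not alter it; its harmlessness can thus be checked at that ancestor's stage. *)
Lemma first_join r x y :
  label (merged r) x = label (merged r) y -> x <> y ->
  exists n, anc fire (S n) r /\
    label (merged (S n)) x = label (merged (S n)) y /\
    (forall z, transport (merged r) x y z = transport (merged (S n)) x y z) /\
    forall z, mem n y z -> ~ pts (marked n) (transport (merged (S n)) x y z).
Proof.
  induction r as [r IH] using lt_wf_ind. intros E N.
  destruct r as [|n]; [exfalso; now apply N|].
  destruct (stage_mergers n) as (p & b & g & L & En & _).
  assert (Hp : anc fire p (S n)) by now exists [b].
  destruct (Nat.eq_dec (label (merged p) x) (label (merged p) y)) as [Ep|D].
  - destruct (IH p ltac:(lia) Ep N) as (m & Hm & Em & Et & Hj).
    destruct (anc_persists _ _ _ _ Hp Ep) as [_ Et'].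
    exists m. split; [|split; [exact Em|split; [|exact Hj]]].
    + destruct Hm as [t Et0]. exists (t ++ [b]). now rewrite En, Et0, app_assoc.
    + intros z. now rewrite Et'.
  - exists n. split; [apply anc_refl|]. split; [exact E|]. split; [reflexivity|].
    intros z. now apply (join_unmarked n p b).
Qed.

(** The second case is a new seed: since its position is h_X g, its copy in the set of [x] is h_x g,
    which the choice of g keeps off the marks. *)
Lemma mem_S_inv n x z : mem (S n) x z ->
  (exists y z', label (merged (S n)) x = label (merged (S n)) y /\ mem n y z' /\
     z = transport (merged (S n)) x y z') \/
  ~ pts (marked n) z.
Proof.
  intros (c & Hc & Ec).
  destruct (stage_spec n) as (p & b & g & _ & _ & Hg & EN & EA & _).
  rewrite EA in Hc. apply in_spread in Hc as (y & d & Hd & L & E & ->).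
  rewrite act_move in Ec. subst z.
  assert (Hold : In (y, d) (elts n) -> exists y0 z', label (merged (S n)) x =
    label (merged (S n)) y0 /\ mem n y0 z' /\
    transport (merged (S n)) x y (act d o) = transport (merged (S n)) x y0 z').
  { intros H. exists y, (act d o). repeat split; [exact E|]. now exists d. }
  unfold seeded in Hd. unfold extend in EN.
  destruct (b =? 0); [left; auto|].
  destruct Hd as [Hd|Hd]; [|left; auto].
  injection Hd as <- <-. right. intros Hw.
  rewrite EN in Hw. unfold witness, transport in Hw. rewrite act_mul, act_invl in Hw.
  now destruct (separates_pulled _ _ _ _ _ x x _ _ Hg L L Hw Hw) as [_ []].
Qed.

(* As long as [a] will be visited again, no later stage puts a guarded number into
   a set: it could only come from another set along a join that is either older
   than [a], and then an ancestor of [a] because visits do not cross, or newer,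
   and then chosen so as to avoid what [a] had marked. *)
Lemma restraint r a t x y z :
  a <= r -> r <= t -> anc fire a t ->
  label (merged a) x = label (merged a) y -> mem r y z ->
  guarded a (transport (merged a) x y z) -> mem a x (transport (merged a) x y z).
Proof.
  revert a t x y z. induction r as [r IH] using lt_wf_ind.
  intros a t x y z Lar Lrt Ha E Hz Hg.
  destruct (Nat.eq_dec a r) as [->|N]; [now apply mem_consistent|].
  destruct r as [|n]; [lia|].
  (* Guarding covers the transport back to [y], which is [z] itself. *)
  assert (Hz' : pts (marked a) z).
  { specialize (Hg x y E). now rewrite transport_trans, transport_refl in Hg. }
  destruct (mem_S_inv _ _ _ Hz) as [(y' & z' & El & Hm & ->)|Hn].
  2: { exfalso. apply Hn, (marked_mono a); [lia|exact Hz']. }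
  destruct (Nat.eq_dec y y') as [<-|Ny].
  { rewrite transport_refl in *. apply (IH n ltac:(lia) a t); auto; lia. }
  destruct (first_join _ _ _ El Ny) as (m & Hq & Eq & Et & Hj).
  pose proof (anc_le _ _ _ Hq) as Lq. rewrite Et in *.
  destruct (Nat.le_gt_cases (S m) a) as [Lqa|Laq].
  - assert (Hqa : anc fire (S m) a)
      by exact (anc_noncrossing fire _ _ _ _ Lqa Lar Lrt Hq Ha).
    destruct (anc_persists _ _ _ _ Hqa Eq) as [Ea Eta].
    rewrite <- Eta, transport_trans in *.
    apply (IH n ltac:(lia) a t); auto; [lia..|congruence].
  - destruct (Nat.eq_dec m n) as [->|Nm].
    { exfalso. apply (Hj z' Hm), (marked_mono a); [lia|exact Hz']. }
    (* The join is newer than [a] but older than this stage. Restraint for [S m] shows that the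
       number was in the set of [y] already when the join was made, and restraint for [a] then
       applies at that earlier stage. *)
    apply (IH (S m) ltac:(lia) a t); auto; [lia..|].
    apply (IH n ltac:(lia) (S m) (S n)); auto; [lia..|].
    now apply (marked_guarded a).
Qed.

(** * The limit sets *)

Definition limit (x z : nat) : Prop := exists n, mem n x z.

Definition recurrent (a : nat) : Prop := forall n, exists s, n <= s /\ anc fire a s.

Lemma limit_transport a x y z :
  recurrent a -> label (merged a) x = label (merged a) y ->
  limit y z -> limit x (transport (merged a) x y z).
Proof.
  intros Hr E [n Hn]. destruct (Hr (S n)) as (s & L & Hs).
  destruct (anc_persists _ _ _ _ Hs E) as [Es Et].
  exists s. rewrite <- Et. apply mem_consistent; [exact Es|].
  apply (mem_mono n); [lia|exact Hn].
Qed.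

(** The seed is the witness. By restraint its Z-preimage could be in the set of [Y k] only if it was
    there at the node's own stage. There, a copy of the seed would need the two indices to be
    equivalent, and a copy of an old element is excluded by [targets]. *)
Lemma limit_diagonal a p b :
  recurrent a -> node fire a = node fire p ++ [b] -> b <> 0 ->
  let k := length (node fire p) in
  label (merged a) (X k) <> label (merged a) (Y k) ->
  exists z, limit (X k) z /\ ~ limit (Y k) (act (inv (Z k)) z).
Proof.
  intros Hr En Hb k D. destruct a as [|n].
  { apply (f_equal (@length _)) in En. rewrite length_app in En. cbn in En. lia. }
  destruct (stage_spec n) as (p' & b' & g & L & En' & Hg & EN & EA & EM).
  rewrite En in En'. apply app_inj_tail in En' as [Ep <-].
  apply subnode_inj in Ep. subst p'. fold k in Hg, EN, EA, EM.
  unfold extend in EN. unfold seeded in EA.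
  destruct (Nat.eqb_spec b 0) as [|_]; [contradiction|].
  set (w := witness k g (merged p)) in *.
  assert (LX : X k <= S n).
  { pose proof (X_le k). pose proof (node_length fire p). unfold k in *. lia. }
  assert (Hw : mem (S n) (X k) (act w o)).
  { exists (move (merged (S n)) (X k) (X k) w).
    split; [|now rewrite act_move, transport_refl].
    rewrite EA. apply in_spread. exists (X k), w. repeat split; [now left|exact LX]. }
  exists (act w o). split; [now exists (S n)|]. intros [m Hm].
  rewrite <- act_mul in Hm. set (v := mul (inv (Z k)) w) in *.
  (* A later entry is pulled back to this stage; [base] marked [v] so that it is guarded. *)
  assert (Hv : mem (S n) (Y k) (act v o)).
  { destruct (Nat.le_gt_cases m (S n)) as [Lm|Lm].
    { exact (mem_mono _ _ _ _ Lm Hm). }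
    destruct (Hr m) as (t & Lt & Ht).
    rewrite <- (transport_refl (merged (S n)) (Y k) (act v o)).
    apply (restraint m (S n) t); auto; [lia|].
    rewrite transport_refl. apply (guarded_saturate _ _ _ EM).
    exists v. split; [now left|reflexivity]. }
  destruct Hv as (c & Hc & Ec). rewrite EA in Hc.
  apply in_spread in Hc as (y & d & Hd & LY & E & ->).
  destruct Hd as [Hd|Hd]; [injection Hd as <- <-; congruence|].
  assert (Ly : y <= n) by (apply (mem_bound n y (act d o)); now exists d).
  destruct (mem_marked n y (act d o)) as (d' & Hd' & Ed'); [now exists d|].
  rewrite act_move, EN in Ec. unfold v, w, witness in Ec. rewrite !act_mul in Ec.
  (* Solved for g, the coincidence [Ec] says that g sends [o] to a point of the second half of
     [targets]. *)
  refine (Hg one (mul (inv (position (merged p) (X k))) (mul (Z k)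
    (mul (position (merged p) (Y k)) (mul (inv (position (merged p) y)) d')))) _ _ _).
  - now left.
  - apply in_or_app. right.
    apply (in_map (fun q => mul (inv (position (merged p) (X k)))
      (mul (Z k) (mul (position (merged p) (Y k)) q)))).
    apply in_pulled; [lia|exact Hd'].
  - rewrite act_one, !act_mul, Ed'. unfold transport in Ec.
    now rewrite Ec, act_invr, act_invl.
Qed.

Lemma label_joined a p :
  node fire a = node fire p ++ [0] ->
  let k := length (node fire p) in
  label (merged a) (X k) = label (merged a) (Y k).
Proof.
  intros En k. destruct a as [|n].
  { apply (f_equal (@length _)) in En. rewrite length_app in En. cbn in En. lia. }
  destruct (stage_mergers n) as (p' & b & g & L & En' & EN).
  rewrite En in En'. apply app_inj_tail in En' as [Ep <-].
  apply subnode_inj in Ep. subst p'. fold k in EN. rewrite EN.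
  unfold extend. rewrite Nat.eqb_refl.
  destruct (place_cons (label (merged p) (X k)) (label (merged p) (Y k)) g (merged p)
    (X k)) as [-> _].
  destruct (place_cons (label (merged p) (X k)) (label (merged p) (Y k)) g (merged p)
    (Y k)) as [-> _].
  rewrite Nat.eqb_refl. now destruct (_ =? _).
Qed.

(** A node's classes are generated by the pairs of its zero outcomes; on the true path these guesses
    recur, so its conjecture is correct as far as it goes. *)
Lemma label_sound (E : nat -> nat -> Prop) a :
  Equivalence E ->
  (forall k, k < length (node fire a) -> nth k (node fire a) 0 = 0 -> E (X k) (Y k)) ->
  forall x, E x (label (merged a) x).
Proof.
  intros HE. induction a as [a IH] using lt_wf_ind. intros Ha x.
  destruct a as [|n]; [reflexivity|].
  destruct (stage_mergers n) as (p & b & g & L & En & EN).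
  assert (Hp : forall x, E x (label (merged p) x)).
  { apply IH; [lia|]. intros k Lk Hk. apply Ha.
    - rewrite En, length_app. lia.
    - now rewrite En, app_nth1. }
  rewrite EN. unfold extend. destruct (Nat.eqb_spec b 0) as [->|_]; [|apply Hp].
  set (k := length (node fire p)) in *.
  destruct (place_cons (label (merged p) (X k)) (label (merged p) (Y k)) g (merged p) x)
    as [-> _].
  destruct (Nat.eqb_spec (label (merged p) x) (label (merged p) (Y k))) as [El|_];
    [|apply Hp].
  transitivity (label (merged p) x); [apply Hp|]. rewrite El.
  transitivity (Y k); [symmetry; apply Hp|].
  transitivity (X k); [symmetry|apply Hp].
  apply Ha.
  - rewrite En, length_app. cbn. unfold k. lia.
  - rewrite En. unfold k. now rewrite app_nth2, Nat.sub_diag by lia.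
Qed.

(** A recurring guess joins [x] and [y] at a true-path node, and h_x h_y⁻¹ carries one limit to the
    other. If they are inequivalent, each [g] has a level whose guess does not recur, and its
    true-path node, not believing in the equivalence, refutes [g]. *)
Lemma limit_classifies (E : nat -> nat -> Prop) :
  Equivalence E ->
  (forall x y, E x y <-> exists k, X k = x /\ Y k = y /\ recurs fire k) ->
  (forall x y g, exists k, X k = x /\ Y k = y /\ Z k = g /\ ~ recurs fire k) ->
  forall x y, E x y <->
    exists g, forall z, limit x z <-> exists w, limit y w /\ z = act g w.
Proof.
  intros HE Hrec Hdiag x y.
  assert (Hpath : forall k, exists a p b, recurrent a /\ node fire a = node fire p ++ [b] /\
    length (node fire p) = k /\ (b = 0 <-> recurs fire k) /\
    forall x y, label (merged a) x = label (merged a) y -> E x y).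
  { intros k. destruct (node_true_path fire (S k)) as (a & Hl & Ht & Ha).
    destruct (node_parent fire a) as (p & b & _ & En).
    { destruct a; [discriminate Hl|lia]. }
    assert (Hp : length (node fire p) = k).
    { rewrite En, length_app in Hl. cbn in Hl. lia. }
    exists a, p, b. split; [exact Ha|]. split; [exact En|]. split; [exact Hp|]. split.
    - rewrite <- (Ht k) by lia. now rewrite En, app_nth2, Hp, Nat.sub_diag by lia.
    - assert (Hs : forall x, E x (label (merged a) x)).
      { apply label_sound; [exact HE|]. intros i Li Hi. apply Hrec. exists i.
        repeat split. apply Ht; [lia|exact Hi]. }
      intros u v El. transitivity (label (merged a) u); [apply Hs|].
      rewrite El. symmetry. apply Hs. }
  split.
  - intros H. apply Hrec in H as (k & HX & HY & Hk).
    destruct (Hpath k) as (a & p & b & Ha & En & Hp & Hb & _).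
    apply Hb in Hk. subst b. pose proof (label_joined a p En) as El.
    cbn zeta in El. rewrite Hp, HX, HY in El.
    exists (mul (position (merged a) x) (inv (position (merged a) y))).
    intros z. split.
    + intros Hz. exists (transport (merged a) y x z). split.
      * now apply limit_transport.
      * rewrite act_mul. fold (transport (merged a) x y (transport (merged a) y x z)).
        now rewrite transport_trans, transport_refl.
    + intros (w & Hw & ->). rewrite act_mul. now apply limit_transport.
  - intros [g Hg]. apply NNPP. intros N.
    destruct (Hdiag x y g) as (k & HX & HY & HZ & Hk).
    destruct (Hpath k) as (a & p & b & Ha & En & Hp & Hb & Hs).
    destruct (limit_diagonal a p b Ha En) as (z & Hz & Hn).
    + tauto.
    + rewrite Hp, HX, HY. eauto.
    + rewrite Hp, HX, HY, HZ in *. apply Hg in Hz as (w & Hw & ->).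
      now rewrite act_invl in Hn.
Qed.

(** * Computability of the construction *)

Hypothesis act_effective : effective2 act.
Hypothesis mul_effective : effective2 mul.
Hypothesis inv_effective : effective inv.
Hypothesis X_effective : effective X.
Hypothesis Y_effective : effective Y.
Hypothesis Z_effective : effective Z.
Hypothesis find_effective : effective2 find.
Hypothesis node_effective : effective (node fire).

Lemma place_effective : effective2 place.
Proof. unfold place. effectivity. Qed.

Lemma label_effective : effective2 label.
Proof. pose proof place_effective. unfold label. effectivity. Qed.

Lemma position_effective : effective2 position.
Proof. pose proof place_effective. unfold position. effectivity. Qed.

Lemma move_effective : effective4 move.
Proof. pose proof position_effective. unfold move. effectivity. Qed.

Lemma pulled_effective : effective3 pulled.
Proof. pose proof position_effective. unfold pulled. effectivity. Qed.

Lemma targets_effective : effective3 targets.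
Proof. pose proof position_effective. unfold targets. effectivity. Qed.

Lemma fresh_effective : effective4 fresh.
Proof.
  pose proof pulled_effective. pose proof targets_effective.
  unfold fresh. effectivity.
Qed.

Lemma extend_effective : effective4 extend.
Proof. pose proof label_effective. unfold extend. effectivity. Qed.

Lemma witness_effective : effective3 witness.
Proof. pose proof position_effective. unfold witness. effectivity. Qed.

Lemma seeded_effective : effective4 seeded.
Proof. unfold seeded. effectivity. Qed.

Lemma spread_effective : effective3 spread.
Proof.
  pose proof label_effective. pose proof move_effective.
  unfold spread. effectivity.
Qed.

Lemma base_effective : effective4 base.
Proof. unfold base. effectivity. Qed.

Lemma saturate_effective : effective3 saturate.
Proof. pose proof move_effective. unfold saturate. effectivity. Qed.

Lemma parent_mergers_effective : effective2 parent_mergers.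
Proof. unfold parent_mergers, lookup. effectivity. Qed.

Lemma stage_effective : effective2 stage.
Proof.
  pose proof parent_mergers_effective. pose proof fresh_effective.
  pose proof extend_effective. pose proof witness_effective.
  pose proof seeded_effective. pose proof spread_effective.
  pose proof base_effective. pose proof saturate_effective.
  unfold stage. effectivity.
Qed.

Lemma elts_effective : effective elts.
Proof.
  pose proof stage_effective. unfold elts, run.
  apply effective_fst, (effective_rect (fun n => n) (fun _ => _) (fun _ n st => stage (S n) st));
    effectivity.
Qed.

Lemma limit_enumeration :
  exists f, computable f /\ forall x z, W (f x) z <-> limit x z.
Proof.
  pose proof elts_effective.
  destruct (effective_enumeration (fun x z n =>
    existsb (fun e => (fst e =? x) && (act (snd e) o =? z)) (elts n))) as (f & Hf & HW).
  { apply (effective_existsb (fun q : nat * nat * nat => elts (snd q))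
      (fun q e => (fst e =? fst (fst q)) && (act (snd e) o =? snd (fst q))));
      effectivity. }
  exists f. split; [exact Hf|]. intros x z. rewrite HW. unfold limit, mem.
  split; intros [n Hn]; exists n.
  - apply existsb_exists in Hn as ([x' c] & Hc & E). cbn in E.
    apply andb_prop in E as [Ex Ez]. apply Nat.eqb_eq in Ex, Ez. subst. eauto.
  - destruct Hn as (c & Hc & <-). apply existsb_exists. exists (x, c).
    split; [exact Hc|]. cbn. now rewrite !Nat.eqb_refl.
Qed.

End Construction.

(** * Guesses *)

Definition bounded_by (q : nat -> nat -> bool) (b m : nat) : bool :=
  forallb (fun b' => existsb (fun c => q b' c) (seq 0 (S m))) (seq 0 (S b)).

(* [⟨b, m⟩] is an event when [m] is the least bound on witnesses for all
   numbers up to [b]; hence each [b] contributes at most one event. *)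
Definition event (q : nat -> nat -> bool) (v : nat) : bool :=
  bounded_by q (pi1 v) (pi2 v) &&
  forallb (fun m => negb (bounded_by q (pi1 v) m)) (seq 0 (pi2 v)).

Lemma bounded_by_spec q b m : bounded_by q b m = true <->
  forall b', b' <= b -> exists c, c <= m /\ q b' c = true.
Proof.
  unfold bounded_by. rewrite forallb_forall. split.
  - intros H b' L. assert (Hb : In b' (seq 0 (S b))) by (apply in_seq; lia).
    apply H, existsb_exists in Hb as (c & Hc & E). apply in_seq in Hc.
    exists c. split; [lia|exact E].
  - intros H b' Hb. apply in_seq in Hb. destruct (H b') as (c & L & E); [lia|].
    apply existsb_exists. exists c. split; [apply in_seq; lia|exact E].
Qed.

Lemma event_spec q b m : event q ⟨b, m⟩ = true <->
  bounded_by q b m = true /\ forall m', bounded_by q b m' = true -> m <= m'.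
Proof.
  unfold event. rewrite pi1_pair, pi2_pair, andb_true_iff, forallb_forall.
  split; intros [H1 H2]; split; try exact H1.
  - intros m' H. destruct (Nat.le_gt_cases m m') as [|L]; [assumption|].
    specialize (H2 m' ltac:(apply in_seq; lia)). now rewrite H in H2.
  - intros m' Hm. apply in_seq in Hm. destruct (bounded_by q b m') eqn:E; [|reflexivity].
    specialize (H2 _ E). lia.
Qed.

(** Each [b] yields at most one event, so late events have large first component and supply
    witnesses for every smaller number. Conversely, if witnesses always exist, the event for [n]
    occurs, at a code no less than [n]. *)
Lemma event_infinitely_often q :
  (forall n, exists v, n <= v /\ event q v = true) <->
  forall b, exists c, q b c = true.
Proof.
  split.
  - intros Hinf b.
    assert (Hlate : exists n, forall v, n <= v -> event q v = true -> b <= pi1 v).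
    { induction b as [|b [n IH]]; [exists 0; lia|].
      destruct (classic (exists m, event q ⟨b, m⟩ = true)) as [[m Hm]|N].
      - exists (Nat.max n (S ⟨b, m⟩)). intros v L Hv.
        specialize (IH v ltac:(lia) Hv).
        destruct (Nat.eq_dec b (pi1 v)) as [Eb|]; [|lia].
        rewrite <- (pair_pi v) in Hv, L. rewrite <- Eb in Hv, L.
        apply event_spec in Hm as [Hm1 Hm2], Hv as [Hv1 Hv2].
        specialize (Hm2 _ Hv1). specialize (Hv2 _ Hm1).
        replace (pi2 v) with m in L by lia. lia.
      - exists n. intros v L Hv. specialize (IH v L Hv).
        destruct (Nat.eq_dec b (pi1 v)) as [->|]; [|lia].
        exfalso. apply N. exists (pi2 v). now rewrite pair_pi. }
    destruct Hlate as [n Hn]. destruct (Hinf n) as (v & L & Hv).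
    specialize (Hn v L Hv). rewrite <- (pair_pi v) in Hv.
    apply event_spec in Hv as [Hv _]. rewrite bounded_by_spec in Hv.
    destruct (Hv b Hn) as (c & _ & E). eauto.
  - intros H n.
    assert (Hm : exists m, bounded_by q n m = true).
    { assert (Hm : exists m, forall b, b <= n -> exists c, c <= m /\ q b c = true).
      { induction n as [|n [m IH]].
        - destruct (H 0) as [c Hc]. exists c. intros b L.
          replace b with 0 by lia. eauto.
        - destruct (H (S n)) as [c Hc]. exists (Nat.max m c). intros b L.
          destruct (Nat.eq_dec b (S n)) as [->|].
          + exists c. split; [lia|exact Hc].
          + destruct (IH b) as (c' & L' & E); [lia|]. exists c'. split; [lia|exact E]. }
      destruct Hm as [m Hm]. exists m. now apply bounded_by_spec. }
    destruct (epsilon_smallest (fun m => bounded_by q n m = true)) as (m & H1 & H2);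
      [intros m; destruct (bounded_by q n m); auto|exact Hm|].
    exists ⟨n, m⟩. split; [apply pair_ge|]. now apply event_spec.
Qed.

(* Level [⟨x, ⟨y, ⟨0, a⟩⟩⟩] guesses that [a] witnesses that [x] and [y] are
   equivalent; level [⟨x, ⟨y, ⟨S g, a⟩⟩⟩] never fires and serves to diagonalise
   against [g]. *)
Definition level_x (k : nat) : nat := pi1 k.
Definition level_y (k : nat) : nat := pi1 (pi2 k).
Definition level_g (k : nat) : nat := Nat.pred (pi1 (pi2 (pi2 k))).

Definition guess (chi : nat -> bool) (k v : nat) : bool :=
  (pi1 (pi2 (pi2 k)) =? 0) &&
  event (fun b c => chi ⟨pi1 k, ⟨pi1 (pi2 k), ⟨pi2 (pi2 (pi2 k)), ⟨b, c⟩⟩⟩⟩) v.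

Lemma guess_effective chi : effective_pred chi ->
  effective_pred (fun q => guess chi (fst q) (snd q)).
Proof.
  intros Hchi.
  assert (Hb : effective3 (fun k b m => Nat.b2n (bounded_by (fun b c =>
    chi ⟨pi1 k, ⟨pi1 (pi2 k), ⟨pi2 (pi2 (pi2 k)), ⟨b, c⟩⟩⟩⟩) b m))).
  { unfold effective3, bounded_by.
    apply (effective_forallb (fun q : nat * (nat * nat) => seq 0 (S (fst (snd q))))
      (fun q b' => existsb (fun c => chi ⟨pi1 (fst q), ⟨pi1 (pi2 (fst q)),
         ⟨pi2 (pi2 (pi2 (fst q))), ⟨b', c⟩⟩⟩⟩) (seq 0 (S (snd (snd q))))));
      [effectivity|].
    apply (effective_existsb
      (fun r : nat * (nat * nat) * nat => seq 0 (S (snd (snd (fst r)))))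
      (fun r c => chi ⟨pi1 (fst (fst r)), ⟨pi1 (pi2 (fst (fst r))),
         ⟨pi2 (pi2 (pi2 (fst (fst r)))), ⟨snd r, c⟩⟩⟩⟩)); effectivity. }
  unfold guess, event. apply effective_and; [effectivity|]. apply effective_and.
  - unfold effective_pred.
    apply (effective_comp3 (fun k b m => Nat.b2n (bounded_by (fun b c =>
      chi ⟨pi1 k, ⟨pi1 (pi2 k), ⟨pi2 (pi2 (pi2 k)), ⟨b, c⟩⟩⟩⟩) b m))
      fst (fun q => pi1 (snd q)) (fun q => pi2 (snd q)) Hb); effectivity.
  - apply (effective_forallb (fun q : nat * nat => seq 0 (pi2 (snd q)))
      (fun q m => negb (bounded_by (fun b c => chi ⟨pi1 (fst q), ⟨pi1 (pi2 (fst q)),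
         ⟨pi2 (pi2 (pi2 (fst q))), ⟨b, c⟩⟩⟩⟩) (pi1 (snd q)) m))); [effectivity|].
    apply effective_neg. unfold effective_pred.
    apply (effective_comp3 (fun k b m => Nat.b2n (bounded_by (fun b c =>
      chi ⟨pi1 k, ⟨pi1 (pi2 k), ⟨pi2 (pi2 (pi2 k)), ⟨b, c⟩⟩⟩⟩) b m))
      (fun r => fst (fst r)) (fun r => pi1 (snd (fst r))) snd Hb); effectivity.
Qed.

Lemma guess_recurs chi k : recurs (guess chi) k <->
  pi1 (pi2 (pi2 k)) = 0 /\
  forall b, exists c, chi ⟨level_x k, ⟨level_y k, ⟨pi2 (pi2 (pi2 k)), ⟨b, c⟩⟩⟩⟩ = true.
Proof.
  unfold recurs, guess. rewrite <- event_infinitely_often.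
  fold (level_y k) (level_x k).
  destruct (Nat.eqb_spec (pi1 (pi2 (pi2 k))) 0) as [E|N]; cbn [andb]; [tauto|].
  split; [|tauto]. intros H. destruct (H 0) as (v & _ & Hv). discriminate Hv.
Qed.

(** * The reduction *)

Theorem theorem3p6 (G : computable_perm_group) :
  (exists x : nat, infinite (orbit G x)) -> sigma03_universal (R_ce G).
Proof.
  intros [o Ho] E HE (P & (chi & Hchi & HP) & HEP).
  destruct (gdom_computable G) as (dom & Hdom & HG).
  (* Reading numbers outside [gdom] as the identity makes all operations total. *)
  set (norm g := if dom g then g else gone G).
  set (act g z := gact G (norm g) z).
  set (mul g h := gmul G (norm g) (norm h)).
  set (inv g := ginv G (norm g)).
  assert (norm_dom : forall g, gdom G (norm g)).
  { intros g. unfold norm. destruct (dom g) eqn:D; [now apply HG|apply gone_dom]. }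
  assert (norm_id : forall g, gdom G g -> norm g = g).
  { intros g Hg. unfold norm. apply HG in Hg. now rewrite Hg. }
  assert (act_one : forall z, act (gone G) z = z).
  { intros z. unfold act. rewrite norm_id by apply gone_dom. apply gact_one. }
  assert (act_mul : forall g h z, act (mul g h) z = act g (act h z)).
  { intros g h z. unfold act, mul. rewrite norm_id by now apply gmul_dom.
    now apply gact_mul. }
  assert (act_invl : forall g z, act (inv g) (act g z) = z).
  { intros g z. unfold act, inv. rewrite (norm_id (ginv _ _)) by now apply ginv_dom.
    rewrite <- gact_mul by (auto using ginv_dom).
    rewrite gmul_inv_l by auto. apply gact_one. }
  assert (act_invr : forall g z, act g (act (inv g) z) = z).
  { intros g z. unfold act, inv. rewrite (norm_id (ginv _ _)) by now apply ginv_dom.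
    rewrite <- gact_mul by (auto using ginv_dom).
    rewrite gmul_inv_r by auto. apply gact_one. }
  assert (Hnorm : effective norm).
  { unfold norm. apply effective_if; [exact Hdom|effectivity..]. }
  assert (Hact : effective2 act).
  { pose proof (effective_computable2 _ (gact_computable G)). unfold act. effectivity. }
  assert (Hmul : effective2 mul).
  { pose proof (effective_computable2 _ (gmul_computable G)). unfold mul. effectivity. }
  assert (Hinv : effective inv).
  { assert (effective (ginv G)) by exact (ginv_computable G). unfold inv. effectivity. }
  assert (Hsep : forall C T, exists k, separates act o k C T).
  { apply (separation act mul inv (gone G)); [assumption..|].
    (* If no element moved [o] off the points of [T], those finitely many points would exhaust the
       orbit. *)
    intros T. apply NNPP. intros N. apply Ho. exists (map (fun t => act t o) T).
    intros z (g & Hg & ->). apply NNPP. intros Hz. apply N. exists g.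
    intros t Ht Et. apply Hz. unfold act in Et. rewrite (norm_id g Hg) in Et.
    rewrite Et. now apply (in_map (fun t => act t o)). }
  destruct (effective_search (fun (q : list nat * list nat) k =>
    forallb (fun c => forallb (fun t => negb (act k (act c o) =? act t o)) (snd q))
      (fst q))) as (search & Hsearch & Hfound).
  { apply (effective_forallb (fun r : list nat * list nat * nat => fst (fst r))
      (fun r c => forallb (fun t => negb (act (snd r) (act c o) =? act t o))
        (snd (fst r)))); [effectivity|].
    apply (effective_forallb (fun r : list nat * list nat * nat * nat => snd (fst (fst r)))
      (fun r t => negb (act (snd (fst r)) (act (snd r) o) =? act t o))); effectivity. }
  { intros [C T]. destruct (Hsep C T) as [k Hk]. exists k.
    apply forallb_forall. intros c Hc. apply forallb_forall. intros t Ht.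
    apply negb_true_iff, Nat.eqb_neq. now apply Hk. }
  set (find C T := search (C, T)).
  assert (Hfind : forall C T, separates act o (find C T) C T).
  { intros C T c t Hc Ht. pose proof (Hfound (C, T)) as F. cbn in F.
    rewrite forallb_forall in F. specialize (F c Hc).
    rewrite forallb_forall in F. specialize (F t Ht).
    now apply negb_true_iff, Nat.eqb_neq in F. }
  assert (Hfind' : effective2 find) by (unfold find; effectivity).
  assert (Lx : forall k, level_x k <= k).
  { intros k. rewrite <- (pair_pi k) at 2. apply pair_ge. }
  assert (Ly : forall k, level_y k <= k).
  { intros k. transitivity (pi2 k).
    - rewrite <- (pair_pi (pi2 k)). apply pair_ge.
    - rewrite <- (pair_pi k) at 2. apply pair_ge. }
  assert (Hlx : effective level_x) by (unfold level_x; effectivity).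
  assert (Hly : effective level_y) by (unfold level_y; effectivity).
  assert (Hlg : effective level_g) by (unfold level_g; effectivity).
  assert (Hnode : effective (node (guess chi))) by now apply node_effective, guess_effective.
  pose proof (limit_classifies act mul inv (gone G) o act_one act_mul act_invl act_invr
    (guess chi) level_x level_y level_g Lx Ly find Hfind E HE) as Hclass.
  destruct (limit_enumeration act mul inv (gone G) o (guess chi) level_x level_y level_g
    find) as (f & Hf & HW); try assumption.
  exists f. split; [exact Hf|]. intros x y. rewrite Hclass.
  - unfold R_ce. setoid_rewrite HW. split.
    + intros [g Hg]. exists (norm g). auto.
    + intros (g & Hg & H). exists g.
      assert (Eg : forall w, act g w = gact G g w)
        by (intros w; unfold act; now rewrite norm_id).
      now setoid_rewrite Eg.
  - clear x y. intros x y. rewrite HEP. split.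
    + intros [a Ha]. exists ⟨x, ⟨y, ⟨0, a⟩⟩⟩. unfold level_x, level_y.
      rewrite guess_recurs. unfold level_x, level_y. rewrite !pi2_pair, !pi1_pair.
      repeat split. intros b. destruct (Ha b) as [c Hc]. exists c. now apply HP.
    + intros (k & <- & <- & Hk). apply guess_recurs in Hk as [_ Hk].
      exists (pi2 (pi2 (pi2 k))). intros b. destruct (Hk b) as [c Hc].
      exists c. now apply HP.
  - clear x y. intros x y g. exists ⟨x, ⟨y, ⟨S g, 0⟩⟩⟩.
    rewrite guess_recurs. unfold level_x, level_y, level_g.
    rewrite !pi2_pair, !pi1_pair. repeat split. intros [H _]. discriminate H.
Qed.
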